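(* $N_4^{*}\leq 516946$.
   Context: $B^{d}=\{\mathbf{x}\in\mathbb{R}^{d} : |\mathbf{x}|\leq 1\}$ is the closed Euclidean unit ball, and $\kappa_d=\mathrm{vol}(B^d)$ is its $d$-dimensional Lebesgue measure. A set $C\subset\mathbb{R}^d$ is a packing (set) if $(\mathbf{x}+\mathrm{int}\,B^d)\cap(\mathbf{y}+\mathrm{int}\,B^d)=\emptyset$ for all distinct $\mathbf{x},\mathbf{y}\in C$. Let $\mathscr{P}_n^d$ be the set of all packing sets in $\mathbb{R}^d$ with exactly $n$ points. The finite packing density of $C\in\mathscr{P}_n^d$ is $\delta(C)=\dfrac{n\,\kappa_d}{\mathrm{vol}(\mathrm{conv}\,C+B^d)}$, where $+$ is Minkowski addition. For $d\geq 2$ and $n\geq 1$ let $\mathscr{C}_n^d\subseteq\mathscr{P}_n^d$ be the set of all packings with greatest density in $\mathscr{P}_n^d$, and let $k(d,n)=\max\{\dim C : C\in\mathscr{C}_n^d\}$, where $\dim C$ is the dimension of the affine hull of $C$. Define $N_d^{*}=\min\{N\in\mathbb{N} : k(d,N')>1\text{ for all integers }N'\geq N\}$, with $\mathbb{N}=\{1,2,\ldots\}$. *)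

(* Defs.v *)
From mathcomp Require Import all_boot all_order all_algebra.
From mathcomp Require Import all_classical all_reals all_analysis measurable_realfun.

Set Implicit Arguments.
Unset Strict Implicit.
Unset Printing Implicit Defensive.

Import Order.TTheory GRing.Theory Num.Theory.
Import numFieldNormedType.Exports.

Local Open Scope classical_set_scope.
Local Open Scope card_scope.
Local Open Scope ring_scope.

Section Volume.
Context {R : realType}.

(* d-fold product of the one-dimensional Lebesgue measure. *)
Fixpoint lebesgue_tuple (d : nat) : set (d.-tuple (measurableTypeR R)) -> \bar R :=
  match d with
  | 0 => dirac [tuple]
  | d'.+1 =>
      pushforward (lebesgue_measure \x @lebesgue_tuple d')%E
        (fun p : measurableTypeR R * d'.-tuple (measurableTypeR R) =>
           [tuple of p.1 :: p.2])
  end.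

Definition volume (d : nat) (A : set 'rV[R]_d) : \bar R :=
  lebesgue_tuple
    [set t : d.-tuple (measurableTypeR R) | A (\row_i (tnth t i : R))].

Lemma volume_box (d : nat) (a b : 'rV[R]_d) :
  (forall i, a 0 i <= b 0 i) ->
  volume [set x | forall i, a 0 i <= x 0 i <= b 0 i]
    = (\prod_i (b 0 i - a 0 i))%:E.
Proof.
rewrite /volume; elim: d a b => [|d IH] a b ab.
  by rewrite big_ord0 /= diracE mem_set//= => -[].
pose a' : 'rV[R]_d := \row_i a 0 (lift ord0 i).
pose b' : 'rV[R]_d := \row_i b 0 (lift ord0 i).
have ab' i : a' 0 i <= b' 0 i by rewrite !mxE.
set B := [set t : d.-tuple _ | forall i,
  a' 0 i <= (\row_j (tnth t j : R)) 0 i <= b' 0 i].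
rewrite big_ord_recl /= /pushforward /product_measure1 /=.
transitivity (\int[lebesgue_measure]_x
  ((\1_(`[a 0 ord0, b 0 ord0]%classic) x)%:E *
   (\prod_i (b' 0 i - a' 0 i))%:E))%E.
  apply: eq_integral.
  move=> x _ /=; rewrite -(IH a' b' ab').
  have xsecE : xsection ((fun p : measurableTypeR R * d.-tuple (measurableTypeR R) =>
      [tuple of p.1 :: p.2]) @^-1` [set t | forall i : 'I_d.+1,
      a 0 i <= (\row_i0 tnth t i0) 0 i <= b 0 i]) x =
      [set t | x \in `[a 0 ord0, b 0 ord0]%classic /\ B t].
    apply/seteqP; split=> t; rewrite /xsection /= inE /=.
      move=> H; split; first by have := H ord0; rewrite mxE inE/= in_itv.
      by move=> i; have := H (lift ord0 i); rewrite !mxE tnthS.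
    move=> [xI Bt] i; case: (unliftP ord0 i) => [j ->|->].
      by have := Bt j; rewrite !mxE tnthS.
    by move: xI; rewrite mxE inE/= in_itv.
  rewrite xsecE indicE; have [xI|xI] := boolP (x \in _).
    rewrite mul1e; congr (lebesgue_tuple _).
    by apply/seteqP; split => t //= [].
  rewrite mul0e (_ : [set t | _] = set0); last by apply/seteqP; split => t //= [].
  by clear; elim: d => [|d IH]; rewrite /= ?diracE ?in_set0 // /pushforward
    /product_measure1 integral0_eq // => x _; rewrite /= preimage_set0 xsection0.
rewrite ge0_integralZr//; first last.
- by rewrite lee_fin; apply: prodr_ge0 => i _; rewrite subr_ge0.
- exact/measurable_EFinP/measurable_indic.
rewrite integral_indic// setIT [X in (X * _)%E](lebesgue_measure_itv `[a 0 ord0, b 0 ord0])/=.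
have -> : \prod_i (b' 0 i - a' 0 i) =
  \prod_(i < d) (b 0 (lift ord0 i) - a 0 (lift ord0 i)).
  by apply: eq_bigr => i _; rewrite !mxE.
have := ab ord0; rewrite le_eqVlt => /orP[/eqP ->|ltab].
  by rewrite lte_fin ltxx mul0e subrr mul0r.
by rewrite lte_fin ltab EFinM.
Qed.

End Volume.

Section Geometry.
Context {R : realType} {d : nat}.
Implicit Types (C A B : set 'rV[R]_d) (x y : 'rV[R]_d).

(* The norm that the library puts on row vectors is the sup norm; it induces
   the same topology, so that the interior of a set is unambiguous. *)
Definition enorm x : R := Num.sqrt (\sum_i x 0 i ^+ 2).

Definition unit_ball : set 'rV[R]_d := [set x | enorm x <= 1].

Definition minkowski_sum A B : set 'rV[R]_d := [set x + y | x in A & y in B].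

Definition conv_hull C : set 'rV[R]_d :=
  smallest (@convex_set R 'rV[R]_d) C.

Definition affine_set A : Prop :=
  forall x y (t : R), A x -> A y -> A ((1 - t) *: x + t *: y).

Definition affine_hull C : set 'rV[R]_d := smallest affine_set C.

Definition affine_dim C : nat :=
  xget 0%N [set k | exists (p : 'rV[R]_d) (V : {vspace 'rV[R]_d}),
              affine_hull C = [set p + v | v in [set` V]] /\ k = \dim V].

Definition is_packing C : Prop :=
  forall x y, C x -> C y -> x <> y ->
    minkowski_sum [set x] unit_ball° `&` minkowski_sum [set y] unit_ball° = set0.

End Geometry.

Section FinitePackings.
Variables (R : realType) (d n : nat).

Definition packings : set (set 'rV[R]_d) :=
  [set C | is_packing C /\ C #= `I_n].

(* The volume of [conv C + B^d] is finite and positive when [C] is finite and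
   nonempty, so that no information is lost with [fine]. *)
Definition packing_density (C : set 'rV[R]_d) : R :=
  n%:R * fine (volume (@unit_ball R d))
    / fine (volume (minkowski_sum (conv_hull C) unit_ball)).

Definition densest_packings : set (set 'rV[R]_d) :=
  [set C | packings C /\
     forall C', packings C' -> packing_density C' <= packing_density C].

(* [max_dim d n] is 0 if [densest_packings] is empty. *)
Definition max_dim : nat :=
  xget 0%N [set k | (exists2 C, densest_packings C & affine_dim C = k) /\
     forall C, densest_packings C -> (affine_dim C <= k)%N].

End FinitePackings.

(* A relation rather than a function: a total minimum would make an upper bound
   trivial if the set were empty. *)
Definition is_Nstar (R : realType) (d N : nat) : Prop :=
  let S := [set M : nat | (0 < M)%N /\
              forall M' : nat, (M <= M')%N -> (1 < max_dim R d M')%N] in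
  S N /\ forall M, S M -> (N <= M)%N.

(* Main.v *)
Require Import Defs.
From HB Require Import structures.
From mathcomp Require Import all_boot all_order all_algebra.
From mathcomp Require Import perm.
From mathcomp Require Import all_classical all_reals all_analysis measurable_realfun.
From mathcomp Require Import ring lra zify ssrZ.

(** Fix a number n of centres, at least 516946, and write k3 for the volume of
    the three-dimensional unit ball.

    A packing of dimension at most one consists of n collinear centres at mutual
    distances at least 2. Two of them are then 2 (n - 1) apart, so conv C + B
    contains a cylinder of that length whose cross-section is a
    three-dimensional unit ball, and its volume is at least 2 (n - 1) k3
    ([volume_collinear_ge]). Hence every densest packing has dimension at least
    two as soon as some packing of n centres does better than this
    ([beats_sausage_ge]). A densest packing has to exist as well, because the
    maximal dimension is 0 otherwise: the hull of a nearly optimal packing has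
    bounded diameter, and a cluster point of a minimizing sequence of
    configurations is a minimizer, since moving every centre by at most e
    multiplies the volume by at most (1 + e) ^ 4 ([exists_minimal_hull]).

    The better packings are cut out of the lattice (2Z)^4 u (2Z + 1)^4, a copy of
    D4 with minimal distance 2 and cell volume 8, less than 2 k3 = 8.37... . The
    shapes are boxes |x_i| <= m_i carrying truncated pyramids of height t_i on
    both facets orthogonal to the axis i; when m_i = t_i = k for all i this is a
    regular 24-cell. The slanted facets lie in the densest lattice hyperplanes,
    for which the number of lattice points exceeds volume / 8 by so much that
    most of the surface term in the volume of conv C + B is paid for. Both the
    number of lattice points and the volume of the shape have closed forms, and
    conv C + B lies in the shape with all its facets pushed outwards
    ([lattice_beats_sausage]). Deleting centres does not increase the hull, so
    one shape serves a whole interval of n; unequal m_i and lowered roofs fill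
    the gaps between consecutive 24-cells. The intervals of the listed shapes
    cover 516946 <= n < 607228165, which is checked in integer arithmetic
    ([coverage_shapes]); from there on the 24-cells alone suffice, since
    such a cell has volume about 32 k ^ 4 and contains about 4 k ^ 4 lattice
    points, and 32 < 4 * 2 k3 ([large_beats_sausage]).

    The volume is an iterated integral. It is monotone and behaves correctly
    under x |-> l x + v for every set, measurable or not ([le_volume],
    [volume_affine]), and for measurable sets it is invariant under rotations,
    because a rotation is a product of three shears ([volume_rot]). A lower
    Riemann sum gives 3.139 as a lower bound for the area of the unit disc, so
    that k3 is at least 4 / 3 * 3.139. *)

Set Implicit Arguments.
Unset Strict Implicit.
Unset Printing Implicit Defensive.

Import Order.TTheory GRing.Theory Num.Theory.
Import numFieldNormedType.Exports.

Local Open Scope classical_set_scope.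
Local Open Scope card_scope.
Local Open Scope ring_scope.

(** * Integrals of nonnegative functions that need not be measurable *)

Section NonnegIntegral.
Context d (T : measurableType d) (R : realType).
Variable mu : {measure set T -> \bar R}.
Import HBNNSimple.
Local Open Scope ereal_scope.

(** The integral of a nonnegative function is a supremum over the simple
    functions below it, so measurability is irrelevant. This makes the volume
    monotone on all sets, in particular on parallel bodies of hulls, whose
    measurability is then never at stake. *)
Lemma ge0_le_integralT (f g : T -> \bar R) :
  (forall x, 0 <= f x) -> (forall x, f x <= g x) ->
  \int[mu]_x f x <= \int[mu]_x g x.
Proof.
move=> f0 fg; have g0 x : 0 <= g x by exact: le_trans (f0 x) (fg x).
rewrite !ge0_integralTE//; apply: le_ereal_sup => _ [h hf <-].
by exists h => // x; exact: le_trans (hf x) (fg x).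
Qed.

(** The universal property of that supremum. *)
Lemma ge0_integralT_le (f : T -> \bar R) (M : \bar R) :
  (forall x, 0 <= f x) ->
  (forall h : {nnsfun T >-> R},
    (forall x, (h x)%:E <= f x) -> \int[mu]_x (h x)%:E <= M) ->
  \int[mu]_x f x <= M.
Proof.
move=> f0 hM; rewrite ge0_integralTE//; apply: ge_ereal_sup => _ [h hf <-].
have := hM h hf; rewrite integral_nnsfun//.
by rewrite patch_setT.
Qed.

Let ge0_integralTZl_le (c : R) (f : T -> \bar R) : (0 < c)%R ->
  (forall x, 0 <= f x) ->
  \int[mu]_x (c%:E * f x) <= c%:E * \int[mu]_x f x.
Proof.
move=> c0 f0; apply: ge0_integralT_le => [x|h hf].
  by rewrite mule_ge0// lee_fin ltW.
rewrite -lee_pdivrMl// -ge0_integralZl//; last 3 first.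
- by apply/measurable_EFinP; exact: measurable_funP.
- by move=> x _; rewrite lee_fin.
- by rewrite lee_fin invr_ge0 ltW.
apply: ge0_le_integralT => x.
  by rewrite mule_ge0// lee_fin// invr_ge0 ltW.
by rewrite lee_pdivrMl.
Qed.

Lemma ge0_integralTZl (c : R) (f : T -> \bar R) : (0 < c)%R ->
  (forall x, 0 <= f x) ->
  \int[mu]_x (c%:E * f x) = c%:E * \int[mu]_x f x.
Proof.
move=> c0 f0; apply/eqP; rewrite eq_le ge0_integralTZl_le//=.
rewrite -lee_pdivlMl//.
have cf0 x : 0 <= c%:E * f x by rewrite mule_ge0// lee_fin ltW.
have ci0 : (0 < c^-1)%R by rewrite invr_gt0.
apply: le_trans (ge0_integralTZl_le ci0 cf0).
rewrite le_eqVlt; apply/orP; left; apply/eqP; apply: eq_integral => x _.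
by rewrite muleA -EFinM mulVf ?mul1e// gt_eqF.
Qed.

End NonnegIntegral.

(** * Affine changes of variable on the line *)

Section PushMeasure.
Context d1 d2 (T1 : measurableType d1) (T2 : measurableType d2) (R : realType).
Variables (m : {measure set T1 -> \bar R}) (f : T1 -> T2).
Hypothesis mf : measurable_fun [set: T1] f.

(** The image measure with the proof of measurability as an argument, so that
    the measure structure can be found from the term. *)
Definition image_measure of measurable_fun [set: T1] f := pushforward m f.

Let image_measure0 : image_measure mf set0 = 0%E. Proof. exact: measure0. Qed.

Let image_measure_ge0 A : (0 <= image_measure mf A)%E. Proof. exact: measure_ge0. Qed.

Let image_measure_sigma_additive : semi_sigma_additive (image_measure mf).
Proof. exact: measure_semi_sigma_additive. Qed.

HB.instance Definition _ := isMeasure.Build _ _ _ (image_measure mf)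
  image_measure0 image_measure_ge0 image_measure_sigma_additive.

End PushMeasure.

Section AffineIntegral.
Context {R : realType}.
Local Notation leb := (@lebesgue_measure R).

Let aff (l v : R) : measurableTypeR R -> measurableTypeR R := fun x => l * x + v.

Let measurable_aff l v : measurable_fun setT (aff l v).
Proof. by apply: measurable_funD => //; exact: measurable_funM. Qed.

(** Both sides are measures with the same values on half-open intervals. *)
Lemma lebesgue_measure_affine (l v : R) (A : set (measurableTypeR R)) :
  0 < l -> measurable A -> leb A = (l%:E * leb ((fun x : R => (l * x + v)%R) @^-1` A))%E.
Proof.
move=> l0 mA.
pose k : {nonneg R} := NngNum (ltW l0).
have mpf := measurable_aff l v.
pose m' : {measure set (measurableTypeR R) -> \bar R} :=
  mscale k (image_measure leb mpf).
rewrite (@lebesgue_measure_unique _ m')//.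
move=> _ [[a b] /= _ <-]; rewrite /m' /mscale/= /pushforward /=.
have -> : aff l v @^-1` `]a, b]%classic =
    (`](a - v) / l, (b - v) / l]%classic : set R).
  apply/seteqP; split=> x /=; rewrite !in_itv/= /aff ltr_pdivrMr// ler_pdivlMr//;
    by rewrite ltrBlDr lerBrDr mulrC.
rewrite !lebesgue_measure_itv/= !lte_fin ltr_pM2r ?invr_gt0// ltrD2r.
case: ifPn => _; last by rewrite mule0.
by rewrite -EFinM -mulrBl opprB addrA subrK mulrC divfK// gt_eqF.
Qed.

Import HBNNSimple.

Let integral_affine_le (l v : R) (f : R -> \bar R) : 0 < l ->
  (forall x, 0 <= f x)%E ->
  (\int[leb]_x f x <= l%:E * \int[leb]_x f (l * x + v)%R)%E.
Proof.
move=> l0 f0; apply: ge0_integralT_le => // h hf.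
pose k : {nonneg R} := NngNum (ltW l0).
have mpf := measurable_aff l v.
have mh : measurable_fun setT (fun x => (h x)%:E).
  by apply/measurable_EFinP; exact: measurable_funP.
have -> : (\int[leb]_x (h x)%:E =
    \int[mscale k (image_measure leb mpf)]_x (h x)%:E)%E.
  apply: eq_measure_integral => //= A mA _.
  by rewrite (lebesgue_measure_affine v l0 mA).
rewrite ge0_integral_mscale//=; last by move=> x _; rewrite lee_fin.
rewrite lee_pmul2l ?fin_numE ?lte_fin//.
rewrite /image_measure ge0_integral_pushforward//= ?preimage_setT; last first.
  by move=> x _; rewrite lee_fin.
by apply: ge0_le_integralT => x //=; rewrite lee_fin.
Qed.

Lemma ge0_integral_affine (l v : R) (f : R -> \bar R) : 0 < l ->
  (forall x, 0 <= f x)%E ->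
  (\int[leb]_x f x = l%:E * \int[leb]_x f (l * x + v)%R)%E.
Proof.
move=> l0 f0; apply/eqP; rewrite eq_le integral_affine_le//=.
have li0 : 0 < l^-1 by rewrite invr_gt0.
have := @integral_affine_le l^-1 (- (v / l)) (fun x => f (l * x + v)) li0.
move=> /(_ (fun=> f0 _)) H.
have -> : (\int[leb]_x f x =
    \int[leb]_x f (l * (l^-1 * x + - (v / l)) + v)%R)%E.
  apply: eq_integral => x _; congr f.
  by field; rewrite gt_eqF.
move: H; rewrite -(@lee_pmul2l _ l%:E) ?lte_fin//.
by rewrite muleA -EFinM divff ?gt_eqF// mul1e.
Qed.

End AffineIntegral.

(** * The volume as an iterated integral *)

Section Volume.
Context {R : realType}.
Local Notation leb := (@lebesgue_measure R).
Local Notation tR := (measurableTypeR R).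

(** The iterated measure is the image of a product of sigma-finite measures
    under the measurable isomorphism (x, t) |-> x :: t; the exhausting sets are
    pulled back along the inverse. *)
Lemma lebesgue_tuple_sigma_finite d :
  exists mu : {sigma_finite_measure set (d.-tuple tR) -> \bar R},
    mu = @lebesgue_tuple R d :> (set (d.-tuple tR) -> \bar R).
Proof.
elim: d => [|d [mu muE]].
  by exists (\d_([tuple] : 0.-tuple tR)).
pose f (p : tR * d.-tuple tR) : d.+1.-tuple tR := [tuple of p.1 :: p.2].
have mf : measurable_fun setT f by exact: measurable_cons.
pose pr : {measure set (tR * d.-tuple tR)%type -> \bar R} := (leb \x mu)%E.
pose m' := image_measure pr mf.
have m's : sigma_finite setT m'.
  have /sigma_finiteP[F [FT ndF Foo]] := sigma_finiteT leb.
  have /sigma_finiteP[G [GT ndG Goo]] := sigma_finiteT mu.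
  pose g (t : d.+1.-tuple tR) : (tR * d.-tuple tR)%type :=
    (tnth t ord0, [tuple of behead t]).
  have fK p : g (f p) = p.
    case: p => x y; rewrite /g /f/=; congr pair.
    by apply/val_inj => /=.
  have gK t : f (g t) = t.
    by rewrite /f /g/= [RHS]tuple_eta; exact/val_inj.
  have mg : measurable_fun setT g.
    apply: measurable_fun_pair => /=; first exact: measurable_tnth.
    exact: measurable_behead.
  exists (fun i => g @^-1` (F i `*` G i)).
    apply/esym/seteqP; split=> // t _.
    have [n _ Fn] : (\bigcup_i F i) (g t).1 by rewrite -FT.
    have [k _ Gk] : (\bigcup_i G i) (g t).2 by rewrite -GT.
    exists (maxn n k) => //; split=> /=.
    - by move: Fn; exact/subsetPset/ndF/leq_maxl.
    - by move: Gk; exact/subsetPset/ndG/leq_maxr.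
  move=> i; have [mFi Fi] := Foo i; have [mGi Gi] := Goo i; split.
    by rewrite -[X in measurable X]setTI; apply: mg => //; exact: measurableX.
  rewrite /m' /image_measure /pushforward (_ : _ @^-1` _ = F i `*` G i).
    by rewrite /= product_measure1E// lte_mul_pinfty// ge0_fin_numE.
  by apply/seteqP; split=> p; rewrite /preimage /mkset -/(f p) fK.
pose mix := Measure_isSigmaFinite.Build _ _ _ m' m's.
pose m'' : {sigma_finite_measure set (d.+1.-tuple tR) -> \bar R} :=
  HB.pack m' mix.
exists m''; apply/funext => A /=.
by rewrite /m'/image_measure /pr /= -muE.
Qed.

Lemma lebesgue_tuple_ge0 d (A : set (d.-tuple tR)) : (0 <= lebesgue_tuple A)%E.
Proof. by have [mu <-] := lebesgue_tuple_sigma_finite d. Qed.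

Definition rv_cons d (x : R) (y : 'rV[R]_d) : 'rV[R]_d.+1 :=
  \row_i oapp (fun j => y 0 j) x (unlift ord0 i).

Lemma rv_cons0 d x (y : 'rV[R]_d) : rv_cons x y 0 ord0 = x.
Proof. by rewrite mxE unlift_none. Qed.

Lemma rv_consS d x (y : 'rV[R]_d) i : rv_cons x y 0 (lift ord0 i) = y 0 i.
Proof. by rewrite mxE liftK. Qed.

Definition rv_tail d (x : 'rV[R]_d.+1) : 'rV[R]_d := \row_i x 0 (lift ord0 i).

Lemma rv_tail_cons d x (y : 'rV[R]_d) : rv_tail (rv_cons x y) = y.
Proof. by apply/rowP => i; rewrite mxE rv_consS. Qed.

Lemma rv_cons_tail d (x : 'rV[R]_d.+1) : rv_cons (x 0 ord0) (rv_tail x) = x.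
Proof.
by apply/rowP => i; rewrite mxE; case: unliftP => [j ->|->] //=; rewrite mxE.
Qed.

Lemma volume_ge0 d (A : set 'rV[R]_d) : (0 <= volume A)%E.
Proof. exact: lebesgue_tuple_ge0. Qed.

Lemma volume0 (A : set 'rV[R]_0) : A 0 -> volume A = 1%:E.
Proof.
move=> A0; rewrite /volume /= diracE mem_set//=.
by rewrite (_ : \row_i _ = 0)//; apply/rowP => -[].
Qed.

(** Cavalieri: slicing along the first coordinate. All the volumes below are
    computed by this recursion. *)
Lemma volumeS d (A : set 'rV[R]_d.+1) :
  volume A = (\int[leb]_x volume [set y | A (rv_cons x y)])%E.
Proof.
rewrite /volume /= /pushforward /product_measure1; apply: eq_integral => x _ /=.
congr lebesgue_tuple; apply/seteqP; split => t;
    rewrite /xsection /= inE /= => At.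
  rewrite (_ : rv_cons _ _ = \row_i tnth [tuple of x :: t] i)//.
  by apply/rowP => i; rewrite !mxE; case: unliftP => [j ->|->] //=;
    rewrite tnthS mxE.
rewrite (_ : \row_i _ = rv_cons x (\row_i tnth t i))//.
by apply/rowP => i; rewrite !mxE; case: unliftP => [j ->|->] //=;
  rewrite tnthS mxE.
Qed.

Lemma le_volume d (A B : set 'rV[R]_d) : A `<=` B -> (volume A <= volume B)%E.
Proof.
elim: d A B => [|d IH] A B AB.
  have [A0|A0] := pselect (A 0); first by rewrite !volume0//; exact: AB.
  rewrite {1}/volume /= (_ : [set _ | _] = set0) ?measure0 ?volume_ge0//.
  apply/seteqP; split => // t /=; rewrite (_ : \row_i _ = 0)//.
  by apply/rowP => -[].
rewrite !volumeS; apply: ge0_le_integralT => x; first exact: volume_ge0.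
by apply: IH => y /AB.
Qed.

Lemma volume_affine d (A : set 'rV[R]_d) (l : R) (v : 'rV[R]_d) : 0 < l ->
  volume A = ((l ^+ d)%:E * volume [set y | A (l *: y + v)%R])%E.
Proof.
move=> l0; elim: d A v => [|d IH] A v.
  rewrite expr0 mul1e; congr volume; apply/seteqP; split=> x /=;
  by rewrite (_ : l *: x + v = x)//; apply/rowP => -[].
rewrite !volumeS (@ge0_integral_affine _ l (v 0 ord0))//; last first.
  by move=> x; exact: volume_ge0.
have -> : (\int[leb]_x volume [set y | A (rv_cons (l * x + v 0 ord0)%R y)] =
  \int[leb]_x ((l ^+ d)%:E *
    volume [set y | A (l *: rv_cons x y + v)%R]))%E.
  apply: eq_integral => x _.
  rewrite (IH _ (rv_tail v)); congr (_ * volume _)%E.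
  have E (y : 'rV[R]_d) : rv_cons (l * x + v 0 ord0) (l *: y + rv_tail v) =
      l *: rv_cons x y + v.
    by apply/rowP => i; rewrite !mxE; case: unliftP => [j ->|->] //=; rewrite !mxE.
  by apply/seteqP; split=> y /=; rewrite E.
rewrite ge0_integralTZl ?exprn_gt0//; last by move=> x; exact: volume_ge0.
by rewrite muleA -EFinM -exprS.
Qed.

End Volume.

(** * Measurable sets of row vectors *)

Section Measurability.
Context {R : realType}.
Local Notation leb := (@lebesgue_measure R).
Local Notation tR := (measurableTypeR R).

Definition rv_of_tuple d (t : d.-tuple tR) : 'rV[R]_d := \row_i (tnth t i : R).

(** Measurability of a set of row vectors is tested on tuples of coordinates,
    because that is where the measure lives. *)
Definition mset d (A : set 'rV[R]_d) :=
  measurable [set t : d.-tuple tR | A (rv_of_tuple t)].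

Definition mfun d (f : 'rV[R]_d -> R) :=
  measurable_fun [set: d.-tuple tR] (fun t => f (rv_of_tuple t) : tR).

Lemma eq_mfun d (f g : 'rV[R]_d -> R) : f =1 g -> mfun g -> mfun f.
Proof. by move=> /funext->. Qed.

Lemma mfun_coord d i : mfun (fun x : 'rV[R]_d => x 0 i).
Proof.
rewrite /mfun; under [X in measurable_fun _ X]eq_fun do rewrite mxE.
exact: measurable_tnth.
Qed.

Lemma mfun_cst d (c : R) : mfun (fun _ : 'rV[R]_d => c).
Proof. exact: measurable_cst. Qed.

Lemma mfunD d (f g : 'rV[R]_d -> R) :
  mfun f -> mfun g -> mfun (fun x => f x + g x).
Proof. exact: measurable_funD. Qed.

Lemma mfunM d (f g : 'rV[R]_d -> R) :
  mfun f -> mfun g -> mfun (fun x => f x * g x).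
Proof. exact: measurable_funM. Qed.

Lemma mfun_norm d (f : 'rV[R]_d -> R) : mfun f -> mfun (fun x => `|f x|).
Proof. exact: measurableT_comp. Qed.

Lemma mfun_sum d n (f : 'I_n -> 'rV[R]_d -> R) :
  (forall i, mfun (f i)) -> mfun (fun x => \sum_i f i x).
Proof. by move=> mf; exact: measurable_sum. Qed.

Lemma mset_le d (f g : 'rV[R]_d -> R) : mfun f -> mfun g ->
  mset [set x | f x <= g x].
Proof.
move=> mf mg; rewrite /mset -[X in measurable X]setTI.
exact: measurable_fun_le.
Qed.

Lemma mset_forall d n (A : 'I_n -> set 'rV[R]_d) : (forall i, mset (A i)) ->
  mset [set x | forall i, A i x].
Proof.
move=> mA; rewrite /mset (_ : [set t | _] =
    \bigcap_(i in [set: 'I_n]) [set t : d.-tuple tR | A i (rv_of_tuple t)]).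
  by apply: fin_bigcap_measurable => // i _; exact: mA.
by apply/seteqP; split => t /= At; [move=> i _; exact: At|move=> i; exact: At].
Qed.

Lemma msetI d (A B : set 'rV[R]_d) : mset A -> mset B -> mset (A `&` B).
Proof. exact: measurableI. Qed.

Lemma mset_exists d n (A : 'I_n -> set 'rV[R]_d) : (forall i, mset (A i)) ->
  mset [set x | exists i, A i x].
Proof.
move=> mA; rewrite /mset (_ : [set t | _] =
    \bigcup_(i in [set: 'I_n]) [set t : d.-tuple tR | A i (rv_of_tuple t)]).
  by apply: fin_bigcup_measurable => // i _; exact: mA.
by apply/seteqP; split=> [t [i Ai]|t [i _ Ai]]; exists i.
Qed.

Lemma mset_preimage d e (f : 'rV[R]_d -> 'rV[R]_e) (A : set 'rV[R]_e) :
  (forall i, mfun (fun x => f x 0 i)) -> mset A -> mset (f @^-1` A).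
Proof.
move=> mf mA; pose g (t : d.-tuple tR) : e.-tuple tR :=
  [tuple f (rv_of_tuple t) 0 i | i < e].
have mg : measurable_fun setT g.
  apply/measurable_fun_tnthP => i.
  rewrite (_ : _ \o g = (fun t => f (rv_of_tuple t) 0 i)); first exact: mf.
  by apply/funext => t /=; rewrite tnth_mktuple.
have := mg measurableT _ mA; rewrite setTI /mset.
rewrite (_ : g @^-1` _ = [set t | (f @^-1` A) (rv_of_tuple t)])//.
have E t : rv_of_tuple (g t) = f (rv_of_tuple t).
  by apply/rowP => i; rewrite mxE tnth_mktuple.
by apply/seteqP; split=> t /=; rewrite E.
Qed.

Lemma volume_set0 d : volume (set0 : set 'rV[R]_d) = 0%E.
Proof.
rewrite /volume; have [mu <-] := @lebesgue_tuple_sigma_finite R d.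
by rewrite (_ : [set _ | _] = set0) ?measure0//; apply/seteqP; split.
Qed.

Lemma volume_setU_le d (A B : set 'rV[R]_d) : mset A -> mset B ->
  (volume (A `|` B) <= volume A + volume B)%E.
Proof.
move=> mA mB; rewrite /volume; have [mu <-] := @lebesgue_tuple_sigma_finite R d.
exact: (measureU2 mu mA mB).
Qed.

Lemma volume_bigcup_le d n (A : 'I_n -> set 'rV[R]_d) :
  (forall i, mset (A i)) ->
  (volume [set x | exists i, A i x] <= \sum_(i < n) volume (A i))%E.
Proof.
elim: n A => [|n IH] A mA.
  rewrite big_ord0 (_ : [set x | _] = set0) ?volume_set0//.
  by apply/seteqP; split => // x [[]].
rewrite big_ord_recl.
have -> : [set x | exists i, A i x] =
    A ord0 `|` [set x | exists i, A (lift ord0 i) x].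
  apply/seteqP; split=> [x [i]|x [Ax|[i Ax]]].
  - by case: (unliftP ord0 i) => [j ->|->]; [right; exists j|left].
  - by exists ord0.
  - by exists (lift ord0 i).
have mU : mset [set x | exists i, A (lift ord0 i) x].
  by apply: mset_exists => i; exact: mA.
apply: le_trans (volume_setU_le (mA ord0) mU) _.
by rewrite leeD2l//; apply: IH => i; exact: mA.
Qed.

End Measurability.

(** * Shears and rotations *)

Section Shears.
Context {R : realType}.
Local Notation leb := (@lebesgue_measure R).
Local Notation tR := (measurableTypeR R).

(** Each slice is translated. *)
Lemma volume_shear_tail d (A : set 'rV[R]_d.+1) (v : 'rV[R]_d) :
  volume [set x : 'rV[R]_d.+1 | A (rv_cons (x 0 ord0) (rv_tail x + x 0 ord0 *: v))] = volume A.
Proof.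
rewrite !volumeS; apply: eq_integral => x _.
rewrite [RHS](volume_affine _ (x *: v) ltr01) expr1n mul1e; congr volume.
by apply/seteqP; split=> y /=; rewrite rv_cons0 rv_tail_cons scale1r.
Qed.

Lemma mset_section d (A : set 'rV[R]_d.+1) (y : 'rV[R]_d) : mset A ->
  measurable [set x : tR | A (rv_cons x y)].
Proof.
move=> mA; pose f (x : tR) : d.+1.-tuple tR :=
  [tuple rv_cons x y 0 i | i < d.+1].
have mf : measurable_fun setT f.
  apply/measurable_fun_tnthP => i.
  rewrite (_ : _ \o f = (fun x => rv_cons x y 0 i)).
    case: (unliftP ord0 i) => [j ->|->].
      by under eq_fun do rewrite rv_consS; exact: measurable_cst.
    by under eq_fun do rewrite rv_cons0; exact: measurable_id.
  by apply/funext => x /=; rewrite tnth_mktuple.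
have := mf measurableT _ mA; rewrite setTI.
rewrite (_ : f @^-1` _ = [set x : tR | A (rv_cons x y)])//.
have E x : rv_of_tuple (f x) = rv_cons x y.
  by apply/rowP => i; rewrite mxE tnth_mktuple.
by apply/seteqP; split=> t /=; rewrite E.
Qed.

(** Slicing along all the coordinates but the first; this is the one place
    where Fubini, hence measurability, is used. *)
Lemma volume_ysection d (mu : {sigma_finite_measure set (d.-tuple tR) -> \bar R})
    (A : set 'rV[R]_d.+1) :
  mu = @lebesgue_tuple R d :> (set (d.-tuple tR) -> \bar R) -> mset A ->
  volume A = (\int[mu]_t leb [set x | A (rv_cons x (rv_of_tuple t))])%E.
Proof.
move=> muE mA; rewrite /volume /= -muE /pushforward.
pose f (p : tR * d.-tuple tR) : d.+1.-tuple tR := [tuple of p.1 :: p.2].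
have mf : measurable_fun setT f by exact: measurable_cons.
rewrite (product_measure_unique (m' := (leb \x^ mu)%E))//; last 2 first.
- by move=> B C mB mC /=; rewrite product_measure2E.
- by rewrite -[X in measurable X]setTI; exact: mf.
rewrite /= /product_measure2; apply: eq_integral => t _ /=; congr (leb _).
have E x : rv_of_tuple [tuple of x :: t] = rv_cons x (rv_of_tuple t).
  by apply/rowP => i; rewrite !mxE; case: unliftP => [j ->|->] //=;
    rewrite tnthS mxE.
by apply/seteqP; split=> x; rewrite /ysection/= inE/= -E.
Qed.

(** The dual slices are translated segments of the line. *)
Lemma volume_shear_head d (A : set 'rV[R]_d.+1) (l : 'rV[R]_d -> R) :
  mset A -> mfun l ->
  volume [set x : 'rV[R]_d.+1 | A (rv_cons (x 0 ord0 + l (rv_tail x)) (rv_tail x))] = volume A.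
Proof.
move=> mA ml; have [mu muE] := @lebesgue_tuple_sigma_finite R d.
rewrite (volume_ysection muE mA) (volume_ysection muE); last first.
  pose f (x : 'rV[R]_d.+1) := rv_cons (x 0 ord0 + l (rv_tail x)) (rv_tail x).
  apply: (@mset_preimage _ _ _ f) => // i.
  rewrite /f; case: (unliftP ord0 i) => [j ->|->].
    apply: (eq_mfun (g := fun x => x 0 (lift ord0 j))); last exact: mfun_coord.
    by move=> x; rewrite rv_consS mxE.
  apply: (eq_mfun (g := fun x => x 0 ord0 + l (rv_tail x))) => [x|].
    by rewrite rv_cons0.
  apply: mfunD; first exact: mfun_coord.
  rewrite /mfun.
  have E (t : d.+1.-tuple tR) : rv_tail (rv_of_tuple t) =
      rv_of_tuple [tuple of behead t].
    by apply/rowP => k; rewrite !mxE [in LHS](tuple_eta t) tnthS.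
  under eq_fun do rewrite E.
  apply: (measurableT_comp ml); exact: measurable_behead.
apply: eq_integral => t _.
have mAt := mset_section (rv_of_tuple t) mA.
rewrite [RHS](lebesgue_measure_affine (l (rv_of_tuple t)) ltr01 mAt) mul1e.
congr (leb _).
by apply/seteqP; split=> x /=; rewrite rv_cons0 rv_tail_cons mul1r.
Qed.

End Shears.

Section Rotation.
Context {R : realType} {d : nat}.

Definition dotp n (x y : 'rV[R]_n) : R := \sum_i x 0 i * y 0 i.

(** The rotation in the plane spanned by the first axis and the unit vector w
    of the remaining coordinates, with cosine c and sine s. *)
Definition rot (w : 'rV[R]_d) (c s : R) (x : 'rV[R]_d.+1) : 'rV[R]_d.+1 :=
  rv_cons (c * x 0 ord0 + s * dotp w (rv_tail x))
    (rv_tail x + ((c - 1) * dotp w (rv_tail x) - s * x 0 ord0) *: w).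

(** A rotation is a product of three shears: by a = s / (1 + c) along the first
    axis, by - s along w, and by a again. This fails only for the half-turn, c
    = -1. *)
Lemma volume_rot (A : set 'rV[R]_d.+1) (w : 'rV[R]_d) (c s : R) :
  dotp w w = 1 -> c ^+ 2 + s ^+ 2 = 1 -> c != -1 -> mset A ->
  volume [set x : 'rV[R]_d.+1 | A (rot w c s x)] = volume A.
Proof.
move=> w1 cs1 cN1 mA.
(* a = tan (theta / 2) for the rotation angle theta *)
pose a := s / (1 + c).
have c1 : 1 + c != 0 by rewrite addrC -(opprK 1) subr_eq0.
pose SA (x : 'rV[R]_d.+1) := rv_cons (x 0 ord0 + a * dotp w (rv_tail x)) (rv_tail x).
pose SB (x : 'rV[R]_d.+1) := rv_cons (x 0 ord0) (rv_tail x + x 0 ord0 *: (- s *: w)).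
have mdot : mfun (fun y => a * dotp w y).
  apply: mfunM; first exact: mfun_cst.
  by apply: mfun_sum => i; apply: mfunM; [exact: mfun_cst|exact: mfun_coord].
have mt (i : 'I_d) : mfun (fun x : 'rV[R]_d.+1 => rv_tail x 0 i).
  apply: (eq_mfun (g := fun x => x 0 (lift ord0 i))); last exact: mfun_coord.
  by move=> x; rewrite mxE.
have mSA i : mfun (fun x => SA x 0 i).
  rewrite /SA; case: (unliftP ord0 i) => [j ->|->].
    by apply: eq_mfun (mt j) => x; rewrite rv_consS.
  apply: (eq_mfun (g := fun x => x 0 ord0 + a * dotp w (rv_tail x))) => [x|].
    by rewrite rv_cons0.
  apply: mfunD; first exact: mfun_coord.
  apply: mfunM; first exact: mfun_cst.
  by apply: mfun_sum => k; apply: mfunM; [exact: mfun_cst|exact: mt].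
have mSB i : mfun (fun x => SB x 0 i).
  rewrite /SB; case: (unliftP ord0 i) => [j ->|->].
    apply: (eq_mfun (g := fun x => rv_tail x 0 j + x 0 ord0 * (- s *: w) 0 j)).
      by move=> x; rewrite rv_consS !mxE.
    by apply: mfunD; [exact: mt|apply: mfunM; [exact: mfun_coord|exact: mfun_cst]].
  apply: (eq_mfun (g := fun x => x 0 ord0)) => [x|]; first by rewrite rv_cons0.
  exact: mfun_coord.
have mA1 := mset_preimage mSA mA.
have mA2 := mset_preimage mSB mA1.
rewrite -[RHS](volume_shear_head mA mdot) -[RHS](volume_shear_tail _ (- s *: w)).
rewrite -[RHS](volume_shear_head mA2 mdot); congr volume.
have dotD (y : 'rV[R]_d) k : dotp w (y + k *: (- s *: w)) = dotp w y - k * s.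
  rewrite /dotp.
  under eq_bigr => i _ do rewrite !mxE mulrDr (mulrCA _ k) (mulrCA _ (- s)) mulrA.
  by rewrite big_split/= -mulr_sumr -/(dotp w w) w1 mulr1 mulrN.
suff E x : rot w c s x = SA (SB (SA x)).
  by apply/seteqP; split=> x /=; rewrite E.
rewrite /rot /SA /SB !(rv_cons0, rv_tail_cons, dotD).
set x0 := x 0 ord0; set y := rv_tail x; set k := dotp w y.
have sE : s ^+ 2 = (1 - c) * (1 + c).
  have -> : s ^+ 2 = 1 - c ^+ 2 by rewrite -cs1 addrAC subrr add0r.
  by ring.
have as2 : a * s = 1 - c by rewrite /a mulrAC -expr2 sE mulfK.
have E : s = a + a * c by rewrite /a; field.
congr rv_cons.
  have -> : x0 + a * k + a * (k - (x0 + a * k) * s) =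
      x0 * (1 - a * s) + k * (a + a * (1 - a * s)) by ring.
  have -> : 1 - a * s = c by rewrite as2; ring.
  by rewrite -E; ring.
congr (_ + _); rewrite scalerA; congr (_ *: _).
have -> : (x0 + a * k) * - s = - (s * x0) - (a * s) * k by ring.
by rewrite as2; ring.
Qed.

End Rotation.

(** * Lower Riemann sums *)

Section RiemannLower.
Context {R : realType}.
Local Notation leb := (@lebesgue_measure R).

(** The step function with value c_j on the j-th cell lies below f. *)
Lemma riemann_lower (f : R -> \bar R) (a e : R) K (c : nat -> R) : 0 < e ->
  (forall x, 0 <= f x)%E -> (forall j, 0 <= c j) ->
  (forall j x, (j < K)%N -> a + j%:R * e <= x -> x < a + j.+1%:R * e ->
     ((c j)%:E <= f x)%E) ->
  ((\sum_(j < K) e * c j)%:E <= \int[leb]_x f x)%E.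
Proof.
move=> e0 f0 c0 cf.
pose G j : set (measurableTypeR R) := `[a + j%:R * e, a + j.+1%:R * e[%classic.
have mG j : measurable (G j) by exact: measurable_itv.
have -> : ((\sum_(j < K) e * c j)%:E =
    \int[leb]_x (\sum_(j < K) (c j)%:E * (\1_(G j) x)%:E))%E.
  rewrite ge0_integral_sum//; last 2 first.
  - move=> j; apply: measurable_funeM; apply/measurable_EFinP.
    exact: measurable_indic.
  - by move=> j x _; rewrite -EFinM lee_fin mulr_ge0// indicE.
  rewrite -sumEFin; apply: eq_bigr => j _.
  rewrite ge0_integralZl//; last 2 first.
  - by apply/measurable_EFinP; exact: measurable_indic.
  - by rewrite lee_fin.
  rewrite integral_indic// setIT [X in (_ * X)%E](lebesgue_measure_itv
    `[a + j%:R * e, a + j.+1%:R * e[)/= lte_fin.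
  by rewrite ltrD2l ltr_pM2r// ltr_nat ltnSn -EFinM; congr (_%:E); ring.
apply: ge0_le_integralT => x.
  by apply: sume_ge0 => j _; rewrite -EFinM lee_fin mulr_ge0// indicE.
have [[j Gj]|NG] := pselect (exists j : 'I_K, G j x).
  rewrite (bigD1 j)//= big1 ?addr0.
    rewrite indicE mem_set// mule1.
    by move: Gj; rewrite /G/= in_itv/= => /andP[? ?]; exact: cf.
  move=> i ij; rewrite indicE memNset ?mule0// => Gi.
  move: Gj Gi; rewrite /G/= !in_itv/= => /andP[j1 j2] /andP[i1 i2].
  (* two cells that share a point have the same index *)
  have lt1 : (j < i.+1)%N.
    have := le_lt_trans j1 i2; rewrite ltrD2l ltr_pM2r// ltr_nat//.
  have lt2 : (i < j.+1)%N.
    have := le_lt_trans i1 j2; rewrite ltrD2l ltr_pM2r// ltr_nat//.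
  by case/eqP: ij; apply/val_inj/eqP; rewrite eqn_leq -ltnS lt2 -ltnS lt1.
rewrite big1// => j _; rewrite indicE memNset ?mule0// => Gj.
by apply: NG; exists j.
Qed.

End RiemannLower.

(** * The Euclidean norm *)

Section DotProduct.
Context {R : realType}.

Lemma dotpE n (x y : 'rV[R]_n.+1) :
  dotp x y = x 0 ord0 * y 0 ord0 + dotp (rv_tail x) (rv_tail y).
Proof.
by rewrite /dotp big_ord_recl; congr (_ + _); apply: eq_bigr => i _; rewrite !mxE.
Qed.

Lemma dotpC n (x y : 'rV[R]_n) : dotp x y = dotp y x.
Proof. by apply: eq_bigr => i _; rewrite mulrC. Qed.

Lemma dotpDr n (x y z : 'rV[R]_n) : dotp x (y + z) = dotp x y + dotp x z.
Proof. by rewrite /dotp -big_split/=; apply: eq_bigr => i _; rewrite mxE mulrDr. Qed.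

Lemma dotpZr n (x y : 'rV[R]_n) a : dotp x (a *: y) = a * dotp x y.
Proof. by rewrite /dotp mulr_sumr; apply: eq_bigr => i _; rewrite mxE mulrCA. Qed.

Lemma dotpDl n (x y z : 'rV[R]_n) : dotp (x + y) z = dotp x z + dotp y z.
Proof. by rewrite dotpC dotpDr !(dotpC z). Qed.

Lemma dotpZl n (x y : 'rV[R]_n) a : dotp (a *: x) y = a * dotp x y.
Proof. by rewrite dotpC dotpZr dotpC. Qed.

Lemma dotp_ge0 n (x : 'rV[R]_n) : 0 <= dotp x x.
Proof. by apply: sumr_ge0 => i _; rewrite -expr2 sqr_ge0. Qed.

Lemma dotp0r n (x : 'rV[R]_n) : dotp x 0 = 0.
Proof. by rewrite /dotp big1// => i _; rewrite mxE mulr0. Qed.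

Lemma dotp_eq0 n (x : 'rV[R]_n) : dotp x x = 0 -> x = 0.
Proof.
move=> /eqP; rewrite psumr_eq0; last by move=> i _; rewrite -expr2 sqr_ge0.
move=> /allP x0; apply/rowP => i; rewrite mxE; apply/eqP.
by have := x0 i; rewrite mem_index_enum -expr2 sqrf_eq0 => /(_ isT).
Qed.

Lemma enormE n (x : 'rV[R]_n) : enorm x = Num.sqrt (dotp x x).
Proof. by rewrite /enorm; congr Num.sqrt; apply: eq_bigr => i _; rewrite expr2. Qed.

Lemma enorm_ge0 n (x : 'rV[R]_n) : 0 <= enorm x.
Proof. exact: sqrtr_ge0. Qed.

Lemma enorm_sqr n (x : 'rV[R]_n) : enorm x ^+ 2 = dotp x x.
Proof. by rewrite enormE sqr_sqrtr// dotp_ge0. Qed.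

Lemma enorm_le n (x : 'rV[R]_n) a : 0 <= a -> (enorm x <= a) = (dotp x x <= a ^+ 2).
Proof.
by move=> a0; rewrite -enorm_sqr ler_pXn2r// ?nnegrE// enorm_ge0.
Qed.

Lemma enormZ n (x : 'rV[R]_n) a : enorm (a *: x) = `|a| * enorm x.
Proof.
rewrite !enormE dotpZl dotpZr mulrA -expr2 sqrtrM ?sqr_ge0//.
by rewrite sqrtr_sqr.
Qed.

Lemma enormN n (x : 'rV[R]_n) : enorm (- x) = enorm x.
Proof. by rewrite -scaleN1r enormZ normrN1 mul1r. Qed.

Lemma enorm0 n : enorm (0 : 'rV[R]_n) = 0.
Proof. by rewrite enormE dotp0r sqrtr0. Qed.

(** Cauchy-Schwarz, from the sign of the square of |y| x - |x| y. *)
Lemma dotp_le_enorm n (x y : 'rV[R]_n) : dotp x y <= enorm x * enorm y.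
Proof.
have [x0|x0] := eqVneq (enorm x) 0.
  have -> : x = 0 by apply: dotp_eq0; rewrite -enorm_sqr x0 expr0n.
  by rewrite enorm0 mul0r dotpC dotp0r.
have [y0|y0] := eqVneq (enorm y) 0.
  have -> : y = 0 by apply: dotp_eq0; rewrite -enorm_sqr y0 expr0n.
  by rewrite enorm0 mulr0 dotp0r.
have px : 0 < enorm x by rewrite lt_neqAle eq_sym x0 enorm_ge0.
have py : 0 < enorm y by rewrite lt_neqAle eq_sym y0 enorm_ge0.
have := dotp_ge0 (enorm y *: x - enorm x *: y).
rewrite -scaleN1r scalerA !(dotpDl, dotpDr, dotpZl, dotpZr) -!enorm_sqr (dotpC y x).
rewrite [X in 0 <= X -> _](_ : _ =
  2 * (enorm x * enorm y) * (enorm x * enorm y - dotp x y)); last by ring.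
by rewrite pmulr_rge0 ?subr_ge0// !mulr_gt0.
Qed.

Lemma enormD n (x y : 'rV[R]_n) : enorm (x + y) <= enorm x + enorm y.
Proof.
rewrite enorm_le ?addr_ge0 ?enorm_ge0// !(dotpDl, dotpDr) -!enorm_sqr (dotpC y x).
have := dotp_le_enorm x y; nra.
Qed.

Lemma coord_le_enorm n (x : 'rV[R]_n) i : `|x 0 i| <= enorm x.
Proof.
rewrite -sqrtr_sqr enormE ler_sqrt ?dotp_ge0// /dotp (bigD1 i)//= -expr2 lerDl.
by apply: sumr_ge0 => j _; rewrite -expr2 sqr_ge0.
Qed.

End DotProduct.

(** * Volume of a capsule in arbitrary direction *)

Section CapsuleVolume.
Context {R : realType}.
Local Notation leb := (@lebesgue_measure R).
Local Notation ball d := (@unit_ball R d).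

Lemma dotp_rot d (w : 'rV[R]_d) c s x : dotp w w = 1 -> c ^+ 2 + s ^+ 2 = 1 ->
  dotp (rot w c s x) (rot w c s x) = dotp x x.
Proof.
move=> w1 cs; rewrite (dotpE (rot w c s x)) (dotpE x) /rot rv_cons0 rv_tail_cons.
rewrite !(dotpDl, dotpDr, dotpZl, dotpZr) w1 (dotpC (rv_tail x) w).
set k := dotp w (rv_tail x); set x0 := x 0 ord0; set y := dotp (rv_tail x) _.
have s2 : s ^+ 2 = 1 - c ^+ 2 by rewrite -cs addrAC subrr add0r.
rewrite [LHS](_ : _ = c ^+ 2 * x0 ^+ 2 + s ^+ 2 * k ^+ 2 + y
  + (c ^+ 2 - 1) * k ^+ 2 + s ^+ 2 * x0 ^+ 2); last by ring.
by rewrite s2; ring.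
Qed.

Lemma rotD d (w : 'rV[R]_d) c s x y :
  rot w c s (x + y) = rot w c s x + rot w c s y.
Proof.
have tD : rv_tail (x + y) = rv_tail x + rv_tail y by apply/rowP => i; rewrite !mxE.
apply/rowP => i; rewrite !mxE; case: unliftP => [j _|_] /=;
  rewrite ?mxE tD dotpDr ?mxE; ring.
Qed.

Lemma rotZ d (w : 'rV[R]_d) c s a x : rot w c s (a *: x) = a *: rot w c s x.
Proof.
have tZ : rv_tail (a *: x) = a *: rv_tail x by apply/rowP => i; rewrite !mxE.
apply/rowP => i; rewrite !mxE; case: unliftP => [j _|_] /=;
  rewrite ?mxE tZ dotpZr ?mxE; ring.
Qed.

Definition cylinder d (L : R) : set 'rV[R]_d.+1 :=
  [set x : 'rV[R]_d.+1 | 0 <= x 0 ord0 /\ x 0 ord0 <= L /\ dotp (rv_tail x) (rv_tail x) <= 1].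

Lemma mfun_dotp_tail d : mfun (fun x : 'rV[R]_d.+1 => dotp (rv_tail x) (rv_tail x)).
Proof.
apply: mfun_sum => i.
apply: (eq_mfun (g := fun x => x 0 (lift ord0 i) * x 0 (lift ord0 i))) => [x|].
  by rewrite !mxE.
by apply: mfunM; exact: mfun_coord.
Qed.

Lemma mset_cylinder d L : mset (@cylinder d L).
Proof.
apply: msetI; first by apply: mset_le; [exact: mfun_cst|exact: mfun_coord].
apply: msetI; first by apply: mset_le; [exact: mfun_coord|exact: mfun_cst].
by apply: mset_le; [exact: mfun_dotp_tail|exact: mfun_cst].
Qed.

Lemma unit_ballE d : ball d = [set x | dotp x x <= 1].
Proof. by apply/seteqP; split => x; rewrite /unit_ball/= enorm_le// expr1n. Qed.

Lemma volume_cylinder d L : 0 <= L ->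
  volume (@cylinder d L) = (L%:E * volume (ball d))%E.
Proof.
move=> L0; rewrite volumeS.
transitivity (\int[leb]_x
    ((\1_(`[0, L]%classic : set (measurableTypeR R)) x)%:E * volume (ball d)))%E.
  apply: eq_integral => x _ /=; rewrite indicE.
  have [xI|xI] := boolP (x \in _).
    move: xI; rewrite inE/= in_itv/= => /andP[x0 xL].
    rewrite mul1e; congr volume; rewrite unit_ballE.
    apply/seteqP; split=> y; rewrite /cylinder /= rv_cons0 rv_tail_cons => //.
    by case=> _ [].
  rewrite mul0e (_ : [set y | _] = set0) ?volume_set0//.
  apply/seteqP; split => // y; rewrite /cylinder/= rv_cons0 => -[x0 [xL _]].
  by case/negP: xI; rewrite inE/= in_itv/= x0.
rewrite ge0_integralZr ?volume_ge0//; last first.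
  exact/measurable_EFinP/measurable_indic.
rewrite integral_indic// setIT [X in (X * _)%E](lebesgue_measure_itv `[0, L])/= lte_fin.
have [_|] := ltP 0 L; first by rewrite oppr0 adde0.
by move=> L0'; have -> : L = 0 by apply/eqP; rewrite eq_le L0' L0.
Qed.

(** Rotate the segment from 0 to q onto the first axis; the capsule then
    contains a straight cylinder. The sign condition on q excludes the
    half-turn, and costs nothing since the ends of a segment can be exchanged.
    *)
Lemma volume_capsule d (q : 'rV[R]_d.+1) : 0 <= q 0 ord0 -> 0 < enorm q ->
  ((enorm q)%:E * volume (ball d) <=
   volume [set x : 'rV[R]_d.+1 | exists2 t : R,
     (0 <= t <= 1)%R & (enorm (x - t *: q) <= 1)%R])%E.
Proof.
move=> q0 L0; rewrite -volume_cylinder; last exact: ltW.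
set L := enorm q; set q' := rv_tail q.
have qE : L ^+ 2 = q 0 ord0 ^+ 2 + enorm q' ^+ 2.
  by rewrite !enorm_sqr dotpE expr2.
have main (r : 'rV[R]_d.+1 -> 'rV[R]_d.+1) :
    volume [set x : 'rV[R]_d.+1 | cylinder L (r x)] = volume (@cylinder d L) ->
    (forall x y, r (x + y) = r x + r y) -> (forall a x, r (a *: x) = a *: r x) ->
    (forall x, dotp (r x) (r x) = dotp x x) -> r q = rv_cons L 0 ->
  (volume (@cylinder d L) <= volume [set x : 'rV[R]_d.+1 | exists2 t : R,
     (0 <= t <= 1)%R & (enorm (x - t *: q) <= 1)%R])%E.
  move=> <- rD rZ r1 rq; apply: le_volume => x [x0 [xL x1]].
  exists (r x 0 ord0 / L).
    by rewrite divr_ge0 ?(ltW L0)//= ler_pdivrMr// mul1r.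
  rewrite enorm_le// expr1n -r1 -scaleNr rD rZ rq.
  rewrite (_ : _ + _ = rv_cons 0 (rv_tail (r x))).
    by rewrite dotpE rv_cons0 rv_tail_cons mul0r add0r.
  apply/rowP => i; rewrite !mxE; case: unliftP => [j ->|->] /=; rewrite ?mxE.
    by rewrite mulr0 addr0.
  by rewrite mulNr divfK ?subrr// gt_eqF.
have [q'0|q'0] := eqVneq (enorm q') 0.
  apply: (main id) => //.
  have {}q'0 : q' = 0 by apply: dotp_eq0; rewrite -enorm_sqr q'0 expr0n.
  rewrite -[LHS]rv_cons_tail -/q' q'0; congr rv_cons.
  by apply/eqP; rewrite -(@eqrXn2 _ 2) ?(ltW L0)// qE q'0 enorm0 expr0n addr0.
have q'_gt0 : 0 < enorm q' by rewrite lt_neqAle eq_sym q'0 enorm_ge0.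
pose w := (enorm q')^-1 *: q'.
pose c := q 0 ord0 / L; pose s := enorm q' / L.
have w1 : dotp w w = 1.
  by rewrite dotpZl dotpZr -enorm_sqr; field.
have cs : c ^+ 2 + s ^+ 2 = 1.
  by rewrite !expr_div_n -mulrDl -qE divff// sqrf_eq0 gt_eqF.
have wq : dotp w q' = enorm q' by rewrite dotpZl -enorm_sqr expr2 mulKf.
apply: (main (rot w c s)).
- apply: volume_rot => //; last exact: mset_cylinder.
  by rewrite gt_eqF// (lt_le_trans (ltrN10 _))// divr_ge0// ltW.
- exact: rotD.
- exact: rotZ.
- by move=> x; exact: dotp_rot.
have L0' : L != 0 by rewrite gt_eqF.
rewrite /rot -/q' wq; congr rv_cons.
  by rewrite /c /s !(mulrAC _ L^-1) -mulrDl -!expr2 -qE expr2 mulfK.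
rewrite -[X in X + _](_ : enorm q' *: w = q'); last first.
  by rewrite scalerA divff// scale1r.
rewrite -scalerDl (_ : _ + _ = 0) ?scale0r//.
by rewrite /c /s; field.
Qed.

End CapsuleVolume.

(** * Volumes of balls *)

Section PolynomialIntegral.
Context {R : realType}.
Local Notation leb := (@lebesgue_measure R).

Lemma integral_deriv_poly (p : {poly R}) (a b : R) : a < b ->
  (\int[leb]_(x in `[a, b]) ((p^`()).[x])%:E = (p.[b] - p.[a])%:E)%E.
Proof.
move=> ab; rewrite (@continuous_FTC2 _ _ (horner p))//.
- apply: derivable_within_continuous => x _; exact: derivable_horner.
- have dp := derivable_horner (p := p).
  split; first by move=> x _; exact: dp.
  + apply: cvg_at_right_filter; apply: differentiable_continuous.
    exact/derivable1_diffP/dp.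
  + apply: cvg_at_left_filter; apply: differentiable_continuous.
    exact/derivable1_diffP/dp.
- by move=> x _; rewrite -derivE.
Qed.

End PolynomialIntegral.

Section BallVolume.
Context {R : realType}.
Local Notation leb := (@lebesgue_measure R).
Local Notation ball d := (@unit_ball R d).

Lemma volume_ball_scale d (r : R) : 0 < r ->
  volume [set y : 'rV[R]_d | dotp y y <= r ^+ 2] = ((r ^+ d)%:E * volume (ball d))%E.
Proof.
move=> r0; rewrite (volume_affine _ 0 r0); congr (_ * volume _)%E.
rewrite unit_ballE; apply/seteqP; split=> y /=;
by rewrite addr0 dotpZl dotpZr mulrA -expr2 ger_pMr// exprn_gt0.
Qed.

Lemma volume_ball_sections d :
  volume (ball d.+1) =
  (\int[leb]_x volume [set y : 'rV[R]_d | (x ^+ 2 + dotp y y <= 1)%R])%E.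
Proof.
rewrite unit_ballE volumeS; apply: eq_integral => x _; congr volume.
by apply/seteqP; split=> y /=; rewrite dotpE rv_cons0 rv_tail_cons expr2.
Qed.

(** The Riemann sum over 2 K cells of width 1 / K on [-1, 1]; the maximum is K
    times the largest |x| in the j-th cell, and b_j / (M K) is a rational lower
    bound for half the chord at that distance from the centre. *)
Lemma volume_disc_ge (K M : nat) (b : nat -> nat) : (0 < K)%N -> (0 < M)%N ->
  (forall j, (j < K + K)%N ->
    (b j ^ 2 + M ^ 2 * (maxn (K - j) (j.+1 - K)) ^ 2 <= M ^ 2 * K ^ 2)%N) ->
  ((2 * (\sum_(j < K + K) b j)%:R / (M * K ^ 2)%:R)%:E <= volume (ball 2))%E.
Proof.
move=> K0 M0 bP; rewrite volume_ball_sections.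
have K0' : 0 < K%:R :> R by rewrite ltr0n.
have M0' : 0 < M%:R :> R by rewrite ltr0n.
have Kn0 : K%:R != 0 :> R by rewrite gt_eqF.
pose c j : R := 2 * (b j)%:R / (M%:R * K%:R).
have -> : 2 * (\sum_(j < K + K) b j)%:R / (M * K ^ 2)%:R =
    \sum_(j < K + K) K%:R^-1 * c j :> R.
  rewrite natr_sum mulr_sumr mulr_suml; apply: eq_bigr => j _.
  rewrite /c natrM natrX; field.
  by rewrite !gt_eqF.
apply: (@riemann_lower _ _ (-1)) => //.
- by rewrite invr_gt0.
- by move=> x; exact: volume_ge0.
- by move=> j; rewrite /c divr_ge0// mulr_ge0// ltW.
move=> j x jK xl xr.
pose r : R := (b j)%:R / (M%:R * K%:R).
have r0 : 0 <= r by rewrite divr_ge0// mulr_ge0// ltW.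
pose m := maxn (K - j) (j.+1 - K).
have xm : `|x| <= m%:R / K%:R.
  rewrite ler_norml; apply/andP; split.
    rewrite lerNl; apply: (@le_trans _ _ (1 - j%:R / K%:R)); first by lra.
    rewrite -{1}(divff Kn0) -mulrBl.
    rewrite ler_pM2r ?invr_gt0// lerBlDr -natrD ler_nat /m.
    lia.
  apply: (@le_trans _ _ (j.+1%:R / K%:R - 1)); first by lra.
  rewrite -[X in _ - X](divff Kn0) -mulrBl.
  rewrite ler_pM2r ?invr_gt0// lerBlDr -natrD ler_nat /m.
  lia.
have rx : x ^+ 2 + r ^+ 2 <= 1.
  have : (b j ^ 2 + M ^ 2 * m ^ 2 <= M ^ 2 * K ^ 2)%N by exact: bP.
  rewrite -(ler_nat R) natrD !natrM -!expr2 => H.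
  have : x ^+ 2 <= (m%:R / K%:R) ^+ 2.
    by rewrite -real_normK ?num_real// lerXn2r ?nnegrE// divr_ge0// ltW.
  move=> x2; apply: le_trans (lerD x2 (lexx (r ^+ 2))) _.
  rewrite /r !expr_div_n exprMn.
  have -> : m%:R ^+ 2 / K%:R ^+ 2 + (b j)%:R ^+ 2 / (M%:R ^+ 2 * K%:R ^+ 2) =
     ((b j)%:R ^+ 2 + M%:R ^+ 2 * m%:R ^+ 2) / (M%:R ^+ 2 * K%:R ^+ 2) :> R.
    by field; rewrite !gt_eqF.
  by rewrite ler_pdivrMr ?mul1r// mulr_gt0// exprn_gt0.
have H : volume [set y : 'rV[R]_1 | forall i, - r <= y 0 i <= r] = (c j)%:E.
  pose u : 'rV[R]_1 := const_mx (- r); pose v : 'rV[R]_1 := const_mx r.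
  have := @volume_box R 1 u v.
  rewrite big_ord1 !mxE opprK (_ : r + r = c j); last by rewrite /c /r; ring.
  move=> <-; last by move=> i; rewrite !mxE; lra.
  congr volume.
  by apply/seteqP; split=> y /= yr i; have := yr i; rewrite !mxE.
rewrite -H.
apply: le_volume => y yr; rewrite /= /dotp big_ord1 -expr2.
apply: le_trans rx; rewrite lerD2l -real_normK ?num_real//.
by rewrite lerXn2r ?nnegrE// ler_norml.
Qed.

(** The slice at height x is a disc of squared radius 1 - x^2, and the integral
    of 1 - x^2 over [-1, 1] is 4 / 3. *)
Lemma volume_ball3_ge (A : R) : 0 <= A -> (A%:E <= volume (ball 2))%E ->
  ((4 / 3 * A)%:E <= volume (ball 3))%E.
Proof.
move=> A0 AV; rewrite volume_ball_sections.
pose p : {poly R} := A *: ('X - 3^-1 *: 'X^3).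
have p' x : (p^`()).[x] = A * (1 - x ^+ 2).
  rewrite /p derivZ derivB derivX derivZ derivXn /= !hornerE /=.
  by field.
have := @integral_deriv_poly R p (-1) 1.
have -> : p.[1] - p.[-1] = 4 / 3 * A by rewrite /p !hornerE /=; field.
move=> <-; last by lra.
rewrite integral_mkcond; apply: ge0_le_integralT => x.
  rewrite /patch; case: ifPn => //; rewrite inE/= in_itv/= p' => /andP[x1 x2].
  rewrite lee_fin mulr_ge0//; nra.
rewrite /patch; case: ifPn => [|_]; last exact: volume_ge0.
rewrite inE/= in_itv/= p' => /andP[x1 x2].
have [x1'|x1'] := leP 1 (x ^+ 2).
  apply: le_trans (volume_ge0 _); rewrite lee_fin mulr_ge0_le0//; lra.
have s0 : 0 < 1 - x ^+ 2 by lra.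
have E : (Num.sqrt (1 - x ^+ 2)) ^+ 2 = 1 - x ^+ 2 by rewrite sqr_sqrtr ?ltW.
rewrite (_ : [set y : 'rV[R]_2 | _] =
    [set y : 'rV[R]_2 | dotp y y <= (Num.sqrt (1 - x ^+ 2)) ^+ 2]).
  rewrite volume_ball_scale ?sqrtr_gt0// E mulrC EFinM lee_pmul2l//.
  by apply/seteqP; split=> y /=; rewrite E; lra.
Qed.

End BallVolume.

(** * Boxes with roofs *)

Section RoofVolume.
Context {R : realType}.
Local Notation leb := (@lebesgue_measure R).

(** The truncated pyramid over the facet sg * x_0 = m0 of a box, of height t:
    at height s above the facet its section is the box with half-sides N_j - s.
    *)
Definition half_roof d (sg m0 t : R) (N : 'I_d -> R) : set 'rV[R]_d.+1 :=
  [set x : 'rV[R]_d.+1 | m0 <= sg * x 0 ord0 /\ sg * x 0 ord0 <= m0 + t /\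
    forall j, `|x 0 (lift ord0 j)| + sg * x 0 ord0 <= N j + m0].

Lemma mset_half_roof d sg m0 t (N : 'I_d -> R) : mset (half_roof sg m0 t N).
Proof.
have ms : mfun (fun x : 'rV[R]_d.+1 => sg * x 0 ord0).
  by apply: mfunM; [exact: mfun_cst|exact: mfun_coord].
apply: msetI; first by apply: mset_le => //; exact: mfun_cst.
apply: msetI; first by apply: mset_le => //; exact: mfun_cst.
apply: mset_forall => j; apply: mset_le; last exact: mfun_cst.
by apply: mfunD => //; apply: mfun_norm; exact: mfun_coord.
Qed.

Lemma volume_sym_box d (a : 'I_d -> R) : (forall j, 0 <= a j) ->
  volume [set y : 'rV[R]_d | forall j, `|y 0 j| <= a j] = (\prod_j (2 * a j))%:E.
Proof.
move=> a0; pose u : 'rV[R]_d := \row_j - a j; pose v : 'rV[R]_d := \row_j a j.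
rewrite (_ : \prod_j _ = \prod_j (v 0 j - u 0 j)); last first.
  by apply: eq_bigr => j _; rewrite !mxE opprK; ring.
rewrite -volume_box; last by move=> j; rewrite !mxE; have := a0 j; lra.
congr volume; apply/seteqP; split=> y /= yr j; have := yr j;
  by rewrite !mxE ler_norml.
Qed.

(** The slice at height s is a box of volume prod (2 (N_j - s)), whose
    antiderivative is q; composing with the affine map that measures the height
    treats both signs at once. *)
Lemma volume_half_roof d (sg m0 t : R) (N : 'I_d -> R) (q : {poly R}) :
  sg ^+ 2 = 1 -> 0 < t -> (forall j, t <= N j) ->
  (forall s, q^`().[s] = \prod_j (2 * (N j - s))) ->
  volume (half_roof sg m0 t N) = (q.[t] - q.[0])%:E.
Proof.
move=> sg1 t0 tN qE.
pose l : {poly R} := sg *: 'X - m0%:P.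
pose p : {poly R} := sg *: (q \Po l).
have lE x : l.[x] = sg * x - m0 by rewrite /l !hornerE.
have pE x : p^`().[x] = \prod_j (2 * (N j - (sg * x - m0))).
  have l' : l^`().[x] = sg by rewrite /l derivB derivZ derivX derivC subr0 alg_polyC hornerC.
  rewrite /p derivZ deriv_comp hornerZ hornerM horner_comp lE qE l'.
  by rewrite mulrCA -expr2 sg1 mulr1.
have [a [b [ab abE abp]]] : exists a b : R, [/\ a < b,
    forall x, (a <= x <= b) = (m0 <= sg * x <= m0 + t) &
    p.[b] - p.[a] = q.[t] - q.[0] ].
  have : (sg == 1) || (sg == -1) by rewrite -sqrf_eq1 sg1.
  move=> /orP[]/eqP sgE.
    exists m0, (m0 + t); split; first by rewrite ltrDl.
    - by move=> x; rewrite sgE mul1r.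
    - by rewrite /p !hornerE !horner_comp !lE sgE !mul1r subrr addrAC subrr add0r.
  exists (- (m0 + t)), (- m0); split; first by rewrite ltrN2 ltrDl.
  - by move=> x; rewrite sgE mulN1r lerNl lerNr andbC.
  - rewrite /p !hornerE !horner_comp !lE sgE !mulN1r !opprK subrr addrAC subrr add0r.
    by rewrite addrC.
rewrite volumeS -abp -integral_deriv_poly// [RHS]integral_mkcond.
apply: eq_integral => x _; rewrite /patch; case: ifPn => xI.
  move: xI; rewrite inE/= in_itv/= abE => /andP[x1 x2].
  rewrite pE -volume_sym_box => [|j]; last by have := tN j; lra.
  congr volume; rewrite /half_roof; apply/seteqP; split=> y /=; rewrite rv_cons0.
    by move=> [_ [_ yj]] j; have := yj j; rewrite rv_consS; lra.
  by move=> yj; do !split=> //; move=> j; have := yj j; rewrite rv_consS; lra.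
rewrite (_ : [set y | _] = set0) ?volume_set0//.
apply/seteqP; split => // y; rewrite /half_roof/= rv_cons0 => -[x1 [x2 _]].
by case/negP: xI; rewrite inE/= in_itv/= abE x1.
Qed.

Definition roof d (M : 'I_d.+1 -> R) (t : R) (i : 'I_d.+1) : set 'rV[R]_d.+1 :=
  [set x : 'rV[R]_d.+1 | M i <= `|x 0 i| /\ `|x 0 i| <= M i + t /\
    forall j, j != i -> `|x 0 j| + `|x 0 i| <= M j + M i].

Lemma mset_roof d M t i : mset (@roof d M t i).
Proof.
have ms j : mfun (fun x : 'rV[R]_d.+1 => `|x 0 j|).
  by apply: mfun_norm; exact: mfun_coord.
apply: msetI; first by apply: mset_le => //; exact: mfun_cst.
apply: msetI; first by apply: mset_le => //; exact: mfun_cst.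
rewrite [X in mset X](_ : _ = [set x | forall j : 'I_d.+1, [set x : 'rV[R]_d.+1 |
   (if j != i then `|x 0 j| + `|x 0 i| else 0) <= (if j != i then M j + M i else 0)] x]).
  apply: mset_forall => j; case: ifP => _; apply: mset_le; try exact: mfun_cst.
  exact: mfunD.
apply/seteqP; split=> x /= H j; have := H j; case: ifP => // _; exact.
Qed.

Lemma volume_roof0_le d (M : 'I_d.+1 -> R) (t : R) (q : {poly R}) : 0 < t ->
  (forall j, t <= M (lift ord0 j)) ->
  (forall s, q^`().[s] = \prod_j (2 * (M (lift ord0 j) - s))) ->
  (volume (roof M t ord0) <= (2 * (q.[t] - q.[0]))%:E)%E.
Proof.
move=> t0 tM qE.
pose N j := M (lift ord0 j).
apply: (@le_trans _ _ (volume (half_roof 1 (M ord0) t N `|` half_roof (-1) (M ord0) t N))).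
  apply: le_volume => x [x1 [x2 x3]].
  have x3' j : `|x 0 (lift ord0 j)| + `|x 0 ord0| <= N j + M ord0 by exact: x3.
  move: x1 x2 x3'; case: (ler0P (x 0 ord0)) => _ x1 x2 x3'; [right|left];
    by rewrite /half_roof/= ?mulN1r ?mul1r.
apply: le_trans (volume_setU_le _ _) _; try exact: mset_half_roof.
rewrite !(volume_half_roof _ _ t0 tM qE) ?sqrrN ?expr1n// -EFinD lee_fin; lra.
Qed.

(** A quarter-turn in the plane of the axes 0 and i exchanges two coordinates
    up to sign, and roofs are symmetric under signs. *)
Lemma volume_roof_swap d (M : 'I_d.+1 -> R) (t : R) (i : 'I_d.+1) :
  volume (roof M t i) = volume (roof (fun k => M (tperm ord0 i k)) t ord0).
Proof.
case: (unliftP ord0 i) => [j ->|->]; last first.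
  rewrite (_ : (fun k => M (tperm ord0 ord0 k)) = M)//.
  by apply/funext => k; rewrite tperm1 perm1.
pose w : 'rV[R]_d := delta_mx 0 j.
have wE (y : 'rV[R]_d) : dotp w y = y 0 j.
  rewrite /dotp (bigD1 j)//= mxE !eqxx mul1r big1 ?addr0// => k kj.
  by rewrite mxE (negbTE kj) andbF mul0r.
have w1 : dotp w w = 1 by rewrite wE mxE !eqxx.
rewrite -[RHS](volume_rot (w := w) (c := 0) (s := 1))//; last 3 first.
- by rewrite expr0n expr1n add0r.
- by rewrite eq_sym oppr_eq0 oner_eq0.
- exact: mset_roof.
set i' := lift ord0 j.
have rE (x : 'rV[R]_d.+1) k : `|rot w 0 1 x 0 k| = `|x 0 (tperm ord0 i' k)|.
  rewrite /rot; case: (unliftP ord0 k) => [l ->|->]; last first.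
    by rewrite rv_cons0 tpermL wE mxE mul0r add0r mul1r.
  rewrite rv_consS !mxE wE mxE eqxx /=; have [->|lj] := eqVneq l j.
    rewrite tpermR -normrN; congr (`| _ |).
    have aux (y z : R) : - (y + ((0 - 1) * y - 1 * z) * 1) = z by ring.
    exact: aux.
  rewrite mulr0 addr0 tpermD//; apply: contra lj => /eqP.
  by move=> /lift_inj ->.
congr volume; apply/seteqP; split=> x /=; rewrite /roof/= !rE !tpermL => -[? [? H]].
  do 2 split=> //; move=> k k0; rewrite rE; apply: H.
  by rewrite -(inj_eq (@perm_inj _ (tperm ord0 i'))) tpermK tpermR.
do 2 split=> //; move=> k k0; have := H (tperm ord0 i' k).
rewrite rE tpermK; apply.
by rewrite -(inj_eq (@perm_inj _ (tperm ord0 i'))) tpermK tpermL.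
Qed.

(** When T_i is at most M_j for all j other than i, this is the box with
    half-sides M_i, together with roofs of height T_i: the pairwise conditions
    allow at most one coordinate to leave the box. *)
Definition roofed_box d (M T : 'I_d -> R) : set 'rV[R]_d :=
  [set x : 'rV[R]_d | (forall i j, i != j -> `|x 0 i| + `|x 0 j| <= M i + M j) /\
    forall i, `|x 0 i| <= M i + T i].

Lemma volume_roofed_box_le d (M T : 'I_d.+1 -> R) (q : 'I_d.+1 -> {poly R}) :
  (forall i, 0 < T i) -> (forall i, 0 <= M i) ->
  (forall i j, T i <= M (tperm ord0 i (lift ord0 j))) ->
  (forall i s, (q i)^`().[s] = \prod_j (2 * (M (tperm ord0 i (lift ord0 j)) - s))) ->
  (volume (roofed_box M T) <=
    (\prod_i (2 * M i) + \sum_i 2 * ((q i).[T i] - (q i).[0]))%:E)%E.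
Proof.
move=> T0 M0 TM qE.
pose bx := [set x : 'rV[R]_d.+1 | forall j, `|x 0 j| <= M j].
have mbx : mset bx.
  apply: mset_forall => j; apply: mset_le; last exact: mfun_cst.
  by apply: mfun_norm; exact: mfun_coord.
have mr := fun i => mset_roof M (T i) i.
apply: (@le_trans _ _ (volume (bx `|` [set x | exists i, roof M (T i) i x]))).
  apply: le_volume => x [x1 x2].
  have [xb|/existsNP[i /negP]] := pselect (bx x); first by left.
  (* the pairwise conditions put x into the roof over its large coordinate *)
  rewrite -ltNge => xi; right; exists i; split; first exact: ltW.
  by split=> // j ji; exact: x1.
have mU := mset_exists mr.
apply: le_trans (volume_setU_le mbx mU) _.
rewrite EFinD volume_sym_box// leeD2l//.
apply: le_trans (volume_bigcup_le mr) _.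
rewrite -sumEFin; apply: lee_sum => i _.
by rewrite volume_roof_swap; apply: volume_roof0_le.
Qed.

End RoofVolume.

Lemma sum_pair (I J : finType) (f : I * J -> nat) :
  (\sum_(p : I * J) f p = \sum_(i : I) \sum_(j : J) f (i, j))%N.
Proof. by rewrite pair_bigA /=; apply: eq_bigr; case. Qed.

(** * Lattice points in a box with roofs *)

Section LatticePoints.
Variables (m t : 'I_4 -> nat) (T : nat).
Hypothesis tT : forall i, (t i <= T)%N.
Hypothesis tm : forall i j, i != j -> (t i <= m j)%N.

(** The two parity classes inside the box, then the layers of the roofs: axis,
    sign and height minus one. *)
Definition layer := (bool + 'I_4 * bool * 'I_T)%type.

(** The number of lattice points of a layer along each coordinate direction. A
    roof layer at height s + 1 has a single point along its own axis and loses
    one point per unit of height along the others; layers above the roof are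
    empty. *)
Definition width (k : layer) (j : 'I_4) : nat :=
  match k with
  | inl b => (b + m j)%N
  | inr (i, b, s) =>
      if (s < t i)%N then if j == i then 1%N else (m j - s)%N else 0%N
  end.

Definition lattice_point := {k : layer & {dffun forall j, 'I_(width k j)}}.

(** A layer is a grid of step 2 centred at the origin, so along a direction of
    width w the coordinates are 2 u - (w - 1). *)
Definition lattice_coord (p : lattice_point) (j : 'I_4) : int :=
  let: existT k u := p in
  match k with
  | inr (i, b, s) =>
      if j == i then (-1) ^+ b * (m i + s.+1)%:Z
      else (2 * u j)%:Z - ((width k j)%:Z - 1)
  | inl _ => (2 * u j)%:Z - ((width k j)%:Z - 1)
  end.

Lemma lattice_coord_box b (u : {dffun forall j, 'I_(width (inl b) j)}) j :
  (`|lattice_coord (existT _ (inl b) u) j| <= m j)%N /\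
  exists z : int, lattice_coord (existT _ (inl b) u) j = 2 * z + (m j)%:Z + (~~ b)%:Z.
Proof.
rewrite /lattice_coord; have := ltn_ord (u j); move: (nat_of_ord (u j)) => w.
case: b {u} => /= wj; split; try lia.
  by exists ((w : int) - (m j)%:Z); lia.
by exists ((w : int) - (m j)%:Z); lia.
Qed.

Lemma lattice_coord_roof i b (s : 'I_T)
    (u : {dffun forall j, 'I_(width (inr (i, b, s)) j)}) j :
  let p : lattice_point := existT _ (inr (i, b, s)) u in
  [/\ (s < t i)%N, (`|lattice_coord p i| = m i + s.+1)%N,
    lattice_coord p i = (-1) ^+ b * (m i + s.+1)%:Z,
    j != i -> (`|lattice_coord p j| + s.+1 <= m j)%N
   & exists z : int, lattice_coord p j = 2 * z + (m j)%:Z + s.+1%:Z].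
Proof.
move=> p; have st : (s < t i)%N.
  have := ltn_ord (u i); move: (nat_of_ord (u i)) => w /=; case: ifP => //.
split=> //.
- by rewrite /p /lattice_coord eqxx; case: b {u p} => /=; lia.
- by rewrite /p /lattice_coord eqxx.
- move=> ji; have := ltn_ord (u j); rewrite /p /lattice_coord (negbTE ji).
  move: (nat_of_ord (u j)) => w; rewrite /= (negbTE ji) st.
  have := tm; rewrite eq_sym in ji => /(_ _ _ ji) tmij; lia.
- have := ltn_ord (u j); rewrite /p /lattice_coord.
  move: (nat_of_ord (u j)) => w; rewrite /= st; case: ifP => ji.
    (* on the axis the sign is absorbed by the even part *)
    move=> _; rewrite (eqP ji); case: (b) => /=.
      by exists (- (m i)%:Z - s.+1%:Z); lia.
    by exists 0; lia.
  have := tm; move/negbT : (ji); rewrite eq_sym => ij /(_ _ _ ij) tmij wj.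
  by exists ((w : int) - (m j)%:Z); lia.
Qed.

(** All points have coordinates congruent to m_j + e modulo 2 for a common e:
    they lie in a translate of (2Z)^4 u (2Z + 1)^4. *)
Lemma lattice_coord_parity p :
  exists e : int, forall j, exists z : int, lattice_coord p j = 2 * z + (m j)%:Z + e.
Proof.
case: p => -[b|[[i b] s]] u.
  by exists (~~ b)%:Z => j; have [] := lattice_coord_box u j.
by exists s.+1%:Z => j; have [] := lattice_coord_roof u j.
Qed.

Lemma lattice_coord_bound p :
  (forall i, (`|lattice_coord p i| <= m i + t i)%N) /\
  (forall i j, i != j -> (`|lattice_coord p i| + `|lattice_coord p j| <= m i + m j)%N).
Proof.
case: p => -[b|[[i b] s]] u; split.
- by move=> i; have [H _] := lattice_coord_box u i; apply: (leq_trans H); lia.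
- move=> i j _; have [H _] := lattice_coord_box u i.
  by have [H' _] := lattice_coord_box u j; exact: leq_add.
- move=> j; have [st si _ sj _] := lattice_coord_roof u j; move: si sj.
  move: (lattice_coord _) => f si sj.
  have [->|ji] := eqVneq j i; first by rewrite si; lia.
  by have := sj ji; lia.
- move=> j k jk.
  have [st si _ sj _] := lattice_coord_roof u j.
  have [_ _ _ sk _] := lattice_coord_roof u k.
  move: si sj sk; move: (lattice_coord _) => f si sj sk.
  have [ji|ji] := eqVneq j i.
    by subst j; have := sk; rewrite eq_sym => /(_ jk); rewrite si; lia.
  have := sj ji; have [ki|ki] := eqVneq k i; last by have := sk ki; lia.
  by subst k; rewrite si; lia.
Qed.

(** The layer can be read off the coordinates: the two classes of the box
    differ by parity, and a roof layer by the only coordinate that exceeds m_i.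
    *)
Lemma lattice_coord_inj p q : lattice_coord p =1 lattice_coord q -> p = q.
Proof.
have fst_eq : lattice_coord p =1 lattice_coord q -> projT1 p = projT1 q.
  case: p q => -[b|[[i b] s]] u [[b'|[[i' b'] s']] v] /= E.
  - have [_ [z]] := lattice_coord_box u ord0; have [_ [z']] := lattice_coord_box v ord0.
    have := E ord0; move: (lattice_coord _ _) (lattice_coord _ _) => x y -> -> H.
    by congr inl; move: H; case: (b) (b') => -[] //=; lia.
  - have [_ si _ _ _] := lattice_coord_roof v i'; have [] := lattice_coord_box u i'.
    have := E i'; move: si; move: (lattice_coord _ _) (lattice_coord _ _) => x y.
    by move=> si -> xi _; lia.
  - have [_ si _ _ _] := lattice_coord_roof u i; have [] := lattice_coord_box v i.
    have := E i; move: si; move: (lattice_coord _ _) (lattice_coord _ _) => x y.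
    by move=> si <- xi _; lia.
  - have [_ si si' _ _] := lattice_coord_roof u i'.
    have [_ ti ti' tj _] := lattice_coord_roof v i.
    move: E si si' ti ti' tj; move: (lattice_coord _) (lattice_coord _) => f g E.
    rewrite !E => si si' ti ti' tj.
    have [ii'|ii'] := eqVneq i i'; last by have := tj ii'; lia.
    subst i'; have ss' : s = s' by apply/val_inj; rewrite /=; lia.
    move: si'; rewrite ti' ss'; case: (b) (b') => -[]//=; lia.
move=> E; have := fst_eq E; case: p q E {fst_eq} => k u [k' v] /= E kk'.
subst k'; congr existT; apply/ffunP => j; apply/val_inj => /=.
have := E j; rewrite /=; case: k u v {E} => [b|[[i b] s]] u v; first by lia.
case: eqP => [->|]; last by lia.
move=> _; have := ltn_ord (u i); have := ltn_ord (v i).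
move: (nat_of_ord (u i)) (nat_of_ord (v i)) => x y; rewrite /= eqxx.
by case: ifP => _; lia.
Qed.

Lemma card_lattice_point : #|{: lattice_point}| =
  (\prod_j (m j).+1 + \prod_j m j +
    \sum_i 2 * \sum_(s < t i) \prod_(j | j != i) (m j - s))%N.
Proof.
rewrite card_tagged sumnE big_map big_enum /=.
under eq_bigr => k _ do rewrite card_dep_ffun foldrE big_map big_enum /=.
rewrite (eq_bigr (fun k => \prod_j width k j)%N); last first.
  by move=> k _; apply: eq_bigr => j _; rewrite card_ord.
rewrite big_sumType /= big_bool /=; congr (_ + _)%N.
rewrite !sum_pair.
apply: eq_bigr => i _; rewrite big_bool /=.
have E b : (\sum_(s < T) \prod_j width (inr (i, b, s)) j =
   \sum_(s < t i) \prod_(j | j != i) (m j - s))%N.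
  rewrite (big_ord_widen _ (fun s => \prod_(j | j != i) (m j - s))%N (tT i)).
  rewrite [RHS]big_mkcond/=; apply: eq_bigr => s _.
  case: ifP => _; last by rewrite (bigD1 ord0).
  rewrite (bigD1 i)//= eqxx mul1n; apply: eq_bigr => j ji.
  by rewrite (negbTE ji).
by rewrite (E true) mul2n -addnn.
Qed.

End LatticePoints.

(** * Packings and convex hulls *)

Section Packings.
Context {R : realType} {d : nat}.
Implicit Types (x y z : 'rV[R]_d) (C : set 'rV[R]_d).

Lemma enorm_le_coord x (e : R) : 0 <= e -> (forall i, `|x 0 i| <= e) ->
  enorm x <= d%:R * e.
Proof.
move=> e0 xe; rewrite enorm_le ?mulr_ge0//.
apply: (@le_trans _ _ (\sum_(i < d) e ^+ 2)).
  apply: ler_sum => i _; rewrite -expr2 -real_normK ?num_real//.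
  by rewrite lerXn2r ?nnegrE.
rewrite sumr_const card_ord -[leLHS]mulr_natl exprMn ler_wpM2r ?sqr_ge0//.
by rewrite -natrX ler_nat; case: (d) => // k; rewrite expnS leq_pmulr// expn_gt0.
Qed.

Lemma nbhs_rowP x (A : set 'rV[R]_d) :
  nbhs x A <-> exists2 e : R, 0 < e & forall y, (forall i, `|x 0 i - y 0 i| < e) -> A y.
Proof.
split.
  move=> /nbhs_ballP[e /= e0 xA]; exists e => // y xy; apply: xA; split=> // i j.
  by rewrite (ord1 i); exact: xy.
move=> [e e0 xA]; apply/nbhs_ballP; exists e => //= y [_ xy]; apply: xA => i.
exact: xy.
Qed.

(** On the unit sphere one can leave the ball radially; inside, the triangle
    inequality leaves room for a ball of the sup norm. *)
Lemma interior_unit_ball : (@unit_ball R d)° = [set x | enorm x < 1].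
Proof.
apply/seteqP; split => x /=.
  move=> /nbhs_rowP[e e0 xB].
  have x1 : enorm x <= 1 by apply: xB => i; rewrite subrr normr0.
  rewrite lt_neqAle x1 andbT; apply/eqP => xE.
  have : enorm ((1 + e / 2) *: x) <= 1.
    apply: xB => i; rewrite mxE mulrDl mul1r opprD addNKr normrN normrM.
    have := coord_le_enorm x i; rewrite xE => xi.
    rewrite (ger0_norm (ltW (divr_gt0 e0 (ltr0Sn R 1)))).
    apply: (@le_lt_trans _ _ (e / 2)); last lra.
    by rewrite ler_piMr// divr_ge0// ltW.
  rewrite enormZ xE mulr1 ger0_norm; lra.
move=> x1; apply/nbhs_rowP; exists ((1 - enorm x) / d.+1%:R).
  by rewrite divr_gt0// subr_gt0.
move=> y xy; rewrite /unit_ball/=.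
rewrite -(subrK x y); apply: le_trans (enormD _ _) _.
rewrite -lerBrDr.
apply: le_trans (enorm_le_coord (e := (1 - enorm x) / d.+1%:R) _ _) _.
- by rewrite divr_ge0// subr_ge0 ltW.
- by move=> i; rewrite !mxE distrC ltW.
rewrite mulrA ler_pdivrMr ?ltr0n// mulrC ler_wpM2l ?subr_ge0 ?(ltW x1)//.
by rewrite ler_nat.
Qed.

(** If two centres are less than 2 apart, their midpoint is in both open balls.
    *)
Lemma is_packingP C :
  is_packing C <-> forall x y, C x -> C y -> x <> y -> 2 <= enorm (x - y).
Proof.
rewrite /is_packing interior_unit_ball; split => H x y Cx Cy xy.
  rewrite leNgt; apply/negP => xy2.
  have : (minkowski_sum [set x] [set u | enorm u < 1] `&`
      minkowski_sum [set y] [set u | enorm u < 1]) (2^-1 *: (x + y)).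
    have n2 : `|2^-1 : R| = 2^-1 by rewrite ger0_norm// invr_ge0.
    split; rewrite /minkowski_sum/=.
      exists x => //; exists (2^-1 *: (y - x)).
        by rewrite /= enormZ n2 -enormN opprB; lra.
      by apply/rowP => i; rewrite !mxE; field.
    exists y => //; exists (2^-1 *: (x - y)).
      by rewrite /= enormZ n2; lra.
    by apply/rowP => i; rewrite !mxE; field.
  by rewrite H.
apply/seteqP; split => // z [[_ -> [u u1 <-]]] [_ -> [v v1 vu]].
have := H x y Cx Cy xy; have -> : x - y = v - u.
  by apply/eqP; rewrite subr_eq addrAC eq_sym subr_eq addrC vu addrC.
rewrite leNgt => /negP; apply; apply: le_lt_trans (enormD _ _) _.
by rewrite enormN; move: u1 v1 => /=; lra.
Qed.

Lemma conv_hull_min C (A : set 'rV[R]_d) :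
  (forall x y (t : R), A x -> A y -> 0 <= t -> t <= 1 -> A (t *: x + (1 - t) *: y)) ->
  C `<=` A -> conv_hull C `<=` A.
Proof.
move=> Acv CA; apply: smallest_sub => // x y l.
by rewrite !inE => Ax Ay; exact: Acv.
Qed.

Lemma conv_hull_seg C x y (t : R) : conv_hull C x -> conv_hull C y ->
  0 <= t -> t <= 1 -> conv_hull C (t *: x + (1 - t) *: y).
Proof.
move=> Cx Cy t0 t1 A [cA CA].
have := cA x y (Itv01 t0 t1); rewrite !inE; apply.
  exact: Cx.
exact: Cy.
Qed.

Lemma sub_conv_hull C : C `<=` conv_hull C.
Proof. exact: sub_smallest. Qed.

End Packings.

(** * Bounds for the volume of the parallel body of a hull *)

Section HullVolume.
Context {R : realType}.

Lemma volume_translate d (A : set 'rV[R]_d) (v : 'rV[R]_d) :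
  volume [set y | A (y + v)] = volume A.
Proof.
rewrite [RHS](volume_affine _ v ltr01) expr1n mul1e; congr volume.
by apply/seteqP; split=> y /=; rewrite scale1r.
Qed.

(** The parallel body of the hull contains the capsule around the segment from
    y to x. *)
Lemma volume_hull_ge_dist d (C : set 'rV[R]_d.+1) (x y : 'rV[R]_d.+1) :
  conv_hull C x -> conv_hull C y ->
  ((enorm (x - y))%:E * volume (@unit_ball R d) <=
    volume (minkowski_sum (conv_hull C) unit_ball))%E.
Proof.
wlog xy : x y / 0 <= (x - y) 0 ord0.
  move=> H Cx Cy; have [xy|xy] := leP 0 ((x - y) 0 ord0); first exact: H.
  by rewrite -enormN opprB; apply: H => //; move: xy; rewrite !mxE; lra.
move=> Cx Cy; have [->|xy0] := eqVneq (enorm (x - y)) 0.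
  by rewrite mul0e volume_ge0.
apply: le_trans (volume_capsule xy _) _.
  by rewrite lt_neqAle eq_sym xy0 enorm_ge0.
rewrite -[leRHS](volume_translate _ y); apply: le_volume => z [t /andP[t0 t1] zt].
exists (t *: x + (1 - t) *: y); first exact: conv_hull_seg.
exists (z - t *: (x - y)); first exact: zt.
by apply/rowP => i; rewrite !mxE; ring.
Qed.

(** In increasing order, consecutive values are at least 2 apart. *)
Lemma separated_spread n (a : 'I_n.+1 -> R) :
  (forall i j, i != j -> 2 <= `|a i - a j|) ->
  exists i j, 2 * n%:R <= a j - a i.
Proof.
move=> sep; pose s := sort <=%R [seq a i | i : 'I_n.+1].
have ss : size s = n.+1 by rewrite size_sort size_map size_enum_ord.
have so : sorted <=%R s by apply: sort_sorted; exact: le_total.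
have us : uniq s.
  rewrite sort_uniq map_inj_uniq ?enum_uniq// => i j aij; apply/eqP/contraT.
  by move=> /sep; rewrite aij subrr normr0; lra.
have sa k : (k < n.+1)%N -> exists i, nth 0 s k = a i.
  move=> kn; have : nth 0 s k \in s by rewrite mem_nth// ss.
  by rewrite mem_sort => /mapP[i _ ->]; exists i.
have st k : (k < n.+1)%N -> nth 0 s 0 + 2 * k%:R <= nth 0 s k.
  elim: k => [|k IH] kn; first by rewrite mulr0 addr0.
  have {}IH := IH (ltnW kn).
  have le1 : nth 0 s k <= nth 0 s k.+1.
    by apply: (sorted_leq_nth le_trans le_refl) => //; rewrite inE ss// ltnW.
  have [i ai] := sa _ (ltnW kn); have [j aj] := sa _ kn.
  have ij : i != j.
    apply/eqP => ij; have /eqP := ai; rewrite ij -aj nth_uniq ?ss//; last exact: ltnW.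
    by rewrite eqn_leq ltnn andbF.
  have := sep _ _ ij; rewrite -ai -aj distrC ger0_norm ?subr_ge0// => h.
  rewrite -natr1; lra.
have [i ai] := sa 0 isT; have [j aj] := sa n (ltnSn n).
by exists i, j; rewrite -ai -aj; have := st n (ltnSn n); lra.
Qed.

Lemma volume_collinear_ge d n (C : set 'rV[R]_d.+1) (f : 'I_n.+1 -> 'rV[R]_d.+1)
    (c v : 'rV[R]_d.+1) :
  (forall i, C (f i)) -> (forall i j, i != j -> 2 <= enorm (f i - f j)) ->
  (forall i, exists t : R, f i = c + t *: v) ->
  ((2 * n%:R)%:E * volume (@unit_ball R d) <=
    volume (minkowski_sum (conv_hull C) unit_ball))%E.
Proof.
move=> Cf sep fE.
have {}fE : forall i, {t : R | f i = c + t *: v} by move=> i; apply/cid.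
pose a i := sval (fE i) * enorm v.
have aE i j : enorm (f i - f j) = `|a i - a j|.
  rewrite (svalP (fE i)) (svalP (fE j)) /a -mulrBl normrM (ger0_norm (enorm_ge0 v)).
  by rewrite -enormZ; congr enorm; apply/rowP => k; rewrite !mxE; ring.
have [i [j aij]] : exists i j, 2 * n%:R <= a j - a i.
  by apply: separated_spread => i j /sep; rewrite aE.
have := volume_hull_ge_dist (sub_conv_hull (Cf j)) (sub_conv_hull (Cf i)).
apply: le_trans; rewrite lee_wpmul2r ?volume_ge0// lee_fin aE.
by apply: le_trans aij _; exact: ler_norm.
Qed.

(** Every facet is moved outwards: |x_i| grows by at most 1, and |x_i| + |x_j|
    by at most sqrt 2, which is at most 2 rho. *)
Lemma hull_sub_roofed_box d (C : set 'rV[R]_d) (M T : 'I_d -> R) (rho : R) :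
  1 <= 2 * rho ^+ 2 -> 0 <= rho ->
  C `<=` roofed_box M T ->
  minkowski_sum (conv_hull C) unit_ball `<=`
    roofed_box (fun i => M i + rho) (fun i => T i + 1 - rho).
Proof.
move=> rho1 rho0 CM _ [x Cx [y y1 <-]].
have [x1 x2] : roofed_box M T x.
  apply: conv_hull_min CM _ Cx => {y1} {}x {}y t [x1 x2] [y1 y2] t0 t1.
  have tn (i : 'I_d) : `|(t *: x + (1 - t) *: y) 0 i| <=
      t * `|x 0 i| + (1 - t) * `|y 0 i|.
    rewrite !mxE; apply: le_trans (ler_normD _ _) _.
    by rewrite !normrM (ger0_norm t0) (ger0_norm (_ : 0 <= 1 - t))// subr_ge0.
  split=> [i j ij|i].
    have := tn i; have := tn j; have := x1 i j ij; have := y1 i j ij; nra.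
  have := tn i; have := x2 i; have := y2 i; nra.
have y1' i : `|y 0 i| <= 1 by apply: le_trans (coord_le_enorm y i) _.
split=> [i j ij|i]; rewrite !mxE; last first.
  by have := ler_normD (x 0 i) (y 0 i); have := x2 i; have := y1' i; lra.
have yy : `|y 0 i| + `|y 0 j| <= 2 * rho.
  have : `|y 0 i| ^+ 2 + `|y 0 j| ^+ 2 <= 1.
    rewrite !real_normK ?num_real//.
    move: y1; rewrite /unit_ball/= enorm_le// expr1n; apply: le_trans.
    rewrite /dotp (bigD1 i)//= (bigD1 j) 1?eq_sym//= -!expr2 addrA lerDl.
    by apply: sumr_ge0 => k _; rewrite -expr2 sqr_ge0.
  set u := `|y 0 i|; set w := `|y 0 j| => uw.
  rewrite -(@ler_pXn2r _ 2) ?nnegrE ?addr_ge0 ?mulr_ge0 ?normr_ge0//.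
  have : 0 <= (u - w) ^+ 2 by exact: sqr_ge0.
  nra.
have := ler_normD (x 0 i) (y 0 i); have := ler_normD (x 0 j) (y 0 j).
by have := x1 i j ij; lra.
Qed.

End HullVolume.

(** * Lattice packings *)

Section LatticePacking.
Context {R : realType}.

Definition lattice_vector (m t : 'I_4 -> nat) T (p : lattice_point m t T) : 'rV[R]_4 :=
  \row_i (lattice_coord p i)%:~R.

(** Two points of the same class differ by an even nonzero amount in some
    coordinate; two points of different classes differ by at least 1 in each of
    the four coordinates. *)
Lemma lattice_vector_dist m t T (p q : lattice_point m t T) :
  (forall i j, i != j -> (t i <= m j)%N) -> p != q ->
  2 <= enorm (lattice_vector p - lattice_vector q).
Proof.
move=> tm pq.
suff : 4 <= dotp (lattice_vector p - lattice_vector q) (lattice_vector p - lattice_vector q).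
  rewrite -enorm_sqr => H; rewrite -(@ler_pXn2r _ 2) ?nnegrE ?enorm_ge0//.
  by apply: le_trans H; rewrite expr2; lra.
pose D i := lattice_coord p i - lattice_coord q i.
have -> : dotp (lattice_vector p - lattice_vector q) (lattice_vector p - lattice_vector q) =
    (\sum_i D i ^+ 2)%:~R.
  rewrite rmorph_sum /=; apply: eq_bigr => i _.
  by rewrite !mxE -rmorphB -expr2 rmorphXn.
suff : 4 <= \sum_i D i ^+ 2 by rewrite -(ler_int R).
have [e ep] := lattice_coord_parity tm p; have [f fq] := lattice_coord_parity tm q.
have D2 i (k : int) : D i <= - k \/ k <= D i -> 0 <= k -> k ^+ 2 <= D i ^+ 2.
  by move: (D i) => x; rewrite !expr2 => xk k0; nia.
have par : (exists z : int, e - f = 2 * z) \/ (exists z : int, e - f = 2 * z + 1).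
  have [H|H] : ((e - f) %% 2)%Z = 0 \/ ((e - f) %% 2)%Z = 1 by lia.
    by left; exists ((e - f) %/ 2)%Z; lia.
  by right; exists ((e - f) %/ 2)%Z; lia.
(* same class: an even nonzero difference; different classes: four odd
   differences *)
case: par => -[z ez].
  have [i Di] : exists i, D i != 0.
    apply/existsP; apply: contraNT pq => /existsPn H; apply/eqP.
    apply: (lattice_coord_inj tm) => i; have := H i; rewrite negbK subr_eq0 => /eqP //.
  rewrite (bigD1 i)//=; apply: (@le_trans _ _ (D i ^+ 2)); last first.
    by rewrite lerDl; apply: sumr_ge0 => j _; exact: sqr_ge0.
  have [x xE] := ep i; have [y yE] := fq i.
  have /D2 H : D i <= - 2 \/ 2 <= D i.
    by move: Di; rewrite /D xE yE => /eqP Di; lia.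
  by apply: le_trans (H _); lia.
apply: (@le_trans _ _ (\sum_(i < 4) 1)); first by rewrite sumr_const card_ord.
apply: ler_sum => i _.
have [x xE] := ep i; have [y yE] := fq i.
have /D2 H : D i <= - 1 \/ 1 <= D i by rewrite /D xE yE; lia.
by apply: le_trans (H _); lia.
Qed.

Lemma injective_packings d n (f : 'I_n -> 'rV[R]_d) :
  (forall i j, i != j -> 2 <= enorm (f i - f j)) ->
  @packings R d n [set f i | i in [set: 'I_n]].
Proof.
move=> sep; split.
  apply/is_packingP => _ _ [i _ <-] [j _ <-] fij; apply: sep.
  by apply/eqP => ij; apply: fij; rewrite ij.
have finj : injective f.
  move=> i j fij; apply/eqP/contraT => /sep; rewrite fij subrr enorm0; lra.
case: n f sep finj => [|n] f sep finj.
  by rewrite (_ : [set f i | i in _] = set0) ?II0//; apply/seteqP; split => // x [[]].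
rewrite (_ : [set f i | i in _] = [set f (inord k) | k in `I_n.+1]).
  apply: inj_card_eq => i j; rewrite !inE/= => ilt jlt /finj ij.
  by rewrite -(inordK ilt) -(inordK jlt) ij.
apply/seteqP; split=> x /= [i].
  by move=> _ <-; exists i => //=; rewrite inord_val.
by move=> _ <-; exists (inord i).
Qed.

Definition lattice_count (m t : 'I_4 -> nat) : nat :=
  (\prod_j (m j).+1 + \prod_j m j +
    \sum_i 2 * \sum_(s < t i) \prod_(j | j != i) (m j - s))%N.

(** Any n of the lattice points will do: deleting points only shrinks the hull.
    *)
Lemma lattice_packing (m t : 'I_4 -> nat) n :
  (forall i j, i != j -> (t i <= m j)%N) -> (n <= lattice_count m t)%N ->
  exists2 C, @packings R 4 n C & C `<=` roofed_box (fun i => (m i)%:R) (fun i => (t i)%:R).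
Proof.
move=> tm nc; pose T := \max_i t i.
have tT i : (t i <= T)%N by exact: (leq_bigmax i).
have nc' : (n <= #|{: lattice_point m t T}|)%N by rewrite (card_lattice_point m tT).
pose p (i : 'I_n) : lattice_point m t T := enum_val (widen_ord nc' i).
have pinj : injective p.
  by move=> i j /enum_val_inj /(congr1 val) /= ij; exact/val_inj.
exists [set lattice_vector (p i) | i in [set: 'I_n]].
  apply: injective_packings => i j ij; apply: lattice_vector_dist => //.
  by rewrite (inj_eq pinj).
move=> _ [i _ <-]; have [b1 b2] := lattice_coord_bound tm (p i).
have E j : `|lattice_vector (p i) 0 j| = (`|lattice_coord (p i) j|)%:R.
  by rewrite mxE -intr_norm -natr_absz.
split=> [j k jk|j]; rewrite /= !E -!natrD ler_nat; [exact: b2|exact: b1].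
Qed.

(** The integral of 8 (a - x) (b - x) (c - x) over [0, s]. *)
Definition roof_integral (a b c s : R) : R :=
  8 * (a * b * c * s - (a * b + b * c + c * a) * s ^+ 2 / 2 +
       (a + b + c) * s ^+ 3 / 3 - s ^+ 4 / 4).

(** The volume of the box with half-sides m_i + rho and roofs of height t_i + 1
    - rho. The transposition of 0 and i lists the three half-sides different
    from the i-th one. *)
Definition roofed_box_bound (m t : 'I_4 -> nat) (rho : R) : R :=
  let M i := (m i)%:R + rho in
  \prod_i (2 * M i) + \sum_i 2 * roof_integral (M (tperm ord0 i (lift ord0 ord0)))
    (M (tperm ord0 i (lift ord0 (lift ord0 ord0))))
    (M (tperm ord0 i (lift ord0 (lift ord0 (lift ord0 ord0)))))
    ((t i)%:R + 1 - rho).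

Definition roof_antiderivative (a b c : R) : {poly R} :=
  8 *: ((a * b * c) *: 'X - ((a * b + b * c + c * a) / 2) *: 'X^2 +
       ((a + b + c) / 3) *: 'X^3 - 4^-1 *: 'X^4).

Lemma roof_antiderivativeE a b c s : (roof_antiderivative a b c).[s] = roof_integral a b c s.
Proof.
rewrite /roof_antiderivative /roof_integral.
by rewrite !(hornerZ, hornerD, hornerN, hornerX, hornerXn); field.
Qed.

Lemma deriv_roof_antiderivative a b c s :
  (roof_antiderivative a b c)^`().[s] = 2 * (a - s) * (2 * (b - s)) * (2 * (c - s)).
Proof.
rewrite /roof_antiderivative derivZ derivB derivD derivB !derivZ derivX !derivXn /= -polyC1.
rewrite !(hornerZ, hornerD, hornerN, hornerMn, hornerX, hornerXn, hornerC).
by field.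
Qed.

Lemma volume_lattice_hull_le (m t : 'I_4 -> nat) (rho : R) (C : set 'rV[R]_4) :
  (forall i j, i != j -> (t i <= m j)%N) -> 1 <= 2 * rho ^+ 2 -> 0 <= rho < 1 ->
  C `<=` roofed_box (fun i => (m i)%:R) (fun i => (t i)%:R) ->
  (volume (minkowski_sum (conv_hull C) unit_ball) <= (roofed_box_bound m t rho)%:E)%E.
Proof.
move=> tm rho1 /andP[rho0 rho2] CM.
apply: le_trans (le_volume (hull_sub_roofed_box rho1 rho0 CM)) _.
pose M i := (m i)%:R + rho.
pose q (i : 'I_4) := roof_antiderivative (M (tperm ord0 i (lift ord0 ord0)))
    (M (tperm ord0 i (lift ord0 (lift ord0 ord0))))
    (M (tperm ord0 i (lift ord0 (lift ord0 (lift ord0 ord0))))).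
apply: le_trans (volume_roofed_box_le (q := q) _ _ _ _) _.
- by move=> i; have : 0 <= (t i)%:R :> R by []; lra.
- by move=> i; rewrite addr_ge0.
- move=> i j; have : (t i <= m (tperm ord0 i (lift ord0 j)))%N.
    apply: tm; rewrite -(inj_eq (@perm_inj _ (tperm ord0 i))) tpermK tpermR.
    by rewrite neq_lift.
  rewrite -(ler_nat R); nra.
- move=> i s; rewrite deriv_roof_antiderivative !big_ord_recl big_ord0 mulr1.
  by rewrite /M !mulrA.
- rewrite lee_fin /roofed_box_bound -/M lerD2l; apply: ler_sum => i _.
  rewrite !roof_antiderivativeE (_ : roof_integral _ _ _ 0 = 0) ?subr0//.
  by rewrite /roof_integral; ring.
Qed.

End LatticePacking.

(** * Packings better than every collinear one *)

Section BeatsSausage.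
Context {R : realType}.

(** 8 / 3 * 3.139 * (n - 1) is a lower bound for 2 (n - 1) k3, which is in turn
    a lower bound for all collinear packings. *)
Definition beats_sausage (n : nat) : Prop :=
  exists2 C, @packings R 4 n C &
    (volume (minkowski_sum (conv_hull C) unit_ball) <
     (8 / 3 * 3139 / 1000 * (n%:R - 1))%:E)%E.

Lemma lattice_beats_sausage (m t : 'I_4 -> nat) n : (n <= lattice_count m t)%N ->
  (forall i j : 'I_4, i != j -> (t i <= m j)%N) ->
  roofed_box_bound m t (29 / 41) < 8 / 3 * 3139 / 1000 * (n%:R - 1) :> R -> beats_sausage n.
Proof.
move=> nc tm vn; have [C pC CM] := @lattice_packing R m t n tm nc.
exists C => //; apply: (@le_lt_trans _ _ (roofed_box_bound m t (29 / 41))%:E).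
  by apply: volume_lattice_hull_le => //; lra.
by rewrite lte_fin.
Qed.

End BeatsSausage.
Arguments beats_sausage R n : clear implicits.

Section ZReal.
Context {R : realType}.

Definition Zr (z : BinInt.Z) : R := (int_of_Z z)%:~R.

Lemma ZrD x y : Zr (BinInt.Z.add x y) = Zr x + Zr y.
Proof. by rewrite /Zr -rmorphD; congr (_%:~R); lia. Qed.

Lemma ZrM x y : Zr (BinInt.Z.mul x y) = Zr x * Zr y.
Proof. by rewrite /Zr -rmorphM; congr (_%:~R); lia. Qed.

Lemma ZrB x y : Zr (BinInt.Z.sub x y) = Zr x - Zr y.
Proof. by rewrite /Zr -rmorphB; congr (_%:~R); lia. Qed.

Lemma Zr_nat n : Zr (BinInt.Z.of_nat n) = n%:R.
Proof. by rewrite /Zr -[RHS]/((n : int)%:~R); congr (_%:~R); lia. Qed.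

Lemma Zr_lt x y : BinInt.Z.lt x y -> Zr x < Zr y.
Proof. by move=> xy; rewrite /Zr ltr_int; lia. Qed.

End ZReal.

Section Coverage.
Import BinInt.
(* importing [BinInt] gives the key N to binary naturals *)
Delimit Scope nat_scope with N.

Definition entry (s : seq nat) (i : 'I_4) : nat := nth 0%N s i.

(** The roofs are not higher than the pyramids that they truncate. *)
Definition roofs_fit (m t : seq nat) : bool :=
  all (fun i => all (fun j => (i == j) || (nth 0 t i <= nth 0 m j)%N) (iota 0 4))
    (iota 0 4).

Fixpoint roof_countZ (a b c : nat) (t : nat) : Z :=
  if t is t'.+1 then
    Z.add (roof_countZ a b c t')
     (Z.mul (Z.of_nat (a - t')) (Z.mul (Z.of_nat (b - t')) (Z.of_nat (c - t'))))
  else Z0.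

Definition lattice_countZ (m t : seq nat) : Z :=
  if (m, t) is ([:: a; b; c; d], [:: p; q; r; s]) then
    let z := Z.of_nat in
    (z a.+1 * z b.+1 * z c.+1 * z d.+1 + z a * z b * z c * z d
     + 2 * (roof_countZ b c d p + roof_countZ a c d q +
            roof_countZ a b d r + roof_countZ a b c s))%Z
  else Z0.

(** [roof_integral], multiplied by 3 to clear its denominators. *)
Definition roof_integralZ (a b c s : Z) : Z :=
  (24 * (a * b * c * s) - 12 * ((a * b + b * c + c * a) * (s * s))
   + 8 * ((a + b + c) * (s * s * s)) - 6 * (s * s * s * s))%Z.

(** The bound for rho = 29 / 41, a rational number slightly larger than sqrt 2
    / 2, multiplied by 3 * 41 ^ 4: then 41 (m + rho) = 41 m + 29 and 41 (t + 1
    - rho) = 41 t + 12 are integers. *)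
Definition roofed_box_boundZ (m t : seq nat) : Z :=
  if (m, t) is ([:: a; b; c; d], [:: p; q; r; s]) then
    let z x := (41 * Z.of_nat x + 29)%Z in
    let y x := (41 * Z.of_nat x + 12)%Z in
    (48 * (z a * z b * z c * z d)
     + 2 * (roof_integralZ (z b) (z c) (z d) (y p) + roof_integralZ (z a) (z c) (z d) (y q)
          + roof_integralZ (z b) (z a) (z d) (y r) + roof_integralZ (z b) (z c) (z a) (y s)))%Z
  else Z0.

(** If the current shape (m, t) beats the sausage already for lo centres, it
    does so for all larger numbers up to its number of lattice points, and the
    next shape has to take over from there. *)
Fixpoint coverage (lo : Z) (ss : seq (seq nat * seq nat)) : option Z :=
  if ss is (m, t) :: certs' then
    if [&& size m == 4, size t == 4, roofs_fit m t &
        Z.ltb (1000 * roofed_box_boundZ m t) (8 * 3139 * (lo - 1) * 41 ^ 4)%Z]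
    then coverage (lattice_countZ m t + 1)%Z certs' else None
  else Some lo.

Definition roof_count (a b c t : nat) : nat :=
  (\sum_(s < t) (a - s) * ((b - s) * (c - s)))%N.

Lemma roof_countZE a b c t :
  roof_countZ a b c t = Z.of_nat (roof_count a b c t).
Proof.
rewrite /roof_count; elim: t => [|t IH] /=; first by rewrite big_ord0.
rewrite big_ord_recr /= IH.
move: (bigop _ _ _) (a - t)%N (b - t)%N (c - t)%N => x y z w; nia.
Qed.

Lemma lattice_countE a b c d p q r s :
  lattice_count (entry [:: a; b; c; d]) (entry [:: p; q; r; s]) =
  (a.+1 * (b.+1 * (c.+1 * d.+1)) + a * (b * (c * d)) +
   2 * (roof_count b c d p + roof_count a c d q + roof_count a b d r + roof_count a b c s))%N.
Proof.
rewrite /lattice_count !big_ord_recl !big_ord0.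
have E (i : 'I_4) (u : nat) f : (forall s0 : 'I_u,
     \prod_(j < 4) (if j != i then entry [:: a; b; c; d] j - s0 else 1) = f s0)%N ->
   (\sum_(s0 < u) \prod_(j | j != i) (entry [:: a; b; c; d] j - s0) =
    \sum_(s0 < u) f s0)%N.
  by move=> fE; apply: eq_bigr => k _; rewrite big_mkcond; exact: fE.
rewrite (E _ _ (fun k => (b - k) * ((c - k) * (d - k)))%N); last first.
  by move=> k; rewrite !big_ord_recl big_ord0 /= /entry /= mul1n muln1.
rewrite (E _ _ (fun k => (a - k) * ((c - k) * (d - k)))%N); last first.
  by move=> k; rewrite !big_ord_recl big_ord0 /= /entry /= mul1n muln1.
rewrite (E _ _ (fun k => (a - k) * ((b - k) * (d - k)))%N); last first.
  by move=> k; rewrite !big_ord_recl big_ord0 /= /entry /= mul1n muln1.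
rewrite (E _ _ (fun k => (a - k) * ((b - k) * (c - k)))%N); last first.
  by move=> k; rewrite !big_ord_recl big_ord0 /= /entry /= !muln1.
by rewrite /entry /roof_count /= !muln1 addn0 !mulnDr !addnA.
Qed.

Lemma lattice_countZE (m t : seq nat) : size m = 4%N -> size t = 4%N ->
  lattice_countZ m t = Z.of_nat (lattice_count (entry m) (entry t)).
Proof.
case: m => [|a [|b [|c [|d [|]]]]] // _; case: t => [|p [|q [|r [|s [|]]]]] // _.
rewrite lattice_countE /lattice_countZ !roof_countZE.
move: (roof_count b c d p) (roof_count a c d q) (roof_count a b d r) (roof_count a b c s).
by move=> x y z w; nia.
Qed.

Lemma roofs_fitP (m t : seq nat) : roofs_fit m t ->
  forall i j : 'I_4, i != j -> (entry t i <= entry m j)%N.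
Proof.
move=> H i j ij.
have iI (k : 'I_4) : (k : nat) \in iota 0 4 by rewrite mem_iota leq0n add0n ltn_ord.
have /orP[/eqP/val_inj/eqP|//] := allP (allP H _ (iI i)) _ (iI j).
by rewrite (negbTE ij).
Qed.

Context {R : realType}.

Lemma Zr_lit (p : positive) : Zr (Zpos p) = (Pos.to_nat p)%:R :> R.
Proof. by rewrite -Zr_nat Znat.positive_nat_Z. Qed.

Lemma roof_integralZE (A B C S : Z) :
  roof_integral (Zr A / 41) (Zr B / 41) (Zr C / 41) (Zr S / 41) =
  Zr (roof_integralZ A B C S) / (3 * 41 ^+ 4) :> R.
Proof.
rewrite /roof_integralZ /roof_integral !(ZrD, ZrM, ZrB) !Zr_lit.
rewrite (_ : Pos.to_nat 24 = 24%N)// (_ : Pos.to_nat 12 = 12%N)//.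
rewrite (_ : Pos.to_nat 8 = 8%N)// (_ : Pos.to_nat 6 = 6%N)//.
by field.
Qed.

Lemma roofed_box_boundE (m t : seq nat) : size m = 4%N -> size t = 4%N ->
  roofed_box_bound (entry m) (entry t) (29 / 41) = Zr (roofed_box_boundZ m t) / (3 * 41 ^+ 4) :> R.
Proof.
case: m => [|a [|b [|c [|d [|]]]]] // _; case: t => [|p [|q [|r [|s [|]]]]] // _.
pose z x := (41 * Z.of_nat x + 29)%Z; pose y x := (41 * Z.of_nat x + 12)%Z.
have zE x : x%:R + 29 / 41 = Zr (z x) / 41 :> R.
  rewrite /z ZrD ZrM !Zr_lit Zr_nat.
  by rewrite (_ : Pos.to_nat 41 = 41%N)// (_ : Pos.to_nat 29 = 29%N)//; field.
have yE x : x%:R + 1 - 29 / 41 = Zr (y x) / 41 :> R.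
  rewrite /y ZrD ZrM !Zr_lit Zr_nat.
  by rewrite (_ : Pos.to_nat 41 = 41%N)// (_ : Pos.to_nat 12 = 12%N)//; field.
rewrite /roofed_box_bound /roofed_box_boundZ -/(z _) -/(y _).
pose o0 : 'I_4 := ord0; pose o1 := lift o0 ord0.
pose o2 : 'I_4 := lift o0 (lift ord0 ord0).
pose o3 : 'I_4 := lift o0 (lift ord0 (lift ord0 ord0)).
rewrite !big_ord_recl !big_ord0 -/o0 -/o1 -/o2 -/o3.
have [c0 c1 c2 c3] : [/\ entry [:: a; b; c; d] o0 = a, entry [:: a; b; c; d] o1 = b,
  entry [:: a; b; c; d] o2 = c & entry [:: a; b; c; d] o3 = d] by [].
have [p0 p1 p2 p3] : [/\ entry [:: p; q; r; s] o0 = p, entry [:: p; q; r; s] o1 = q,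
  entry [:: p; q; r; s] o2 = r & entry [:: p; q; r; s] o3 = s] by [].
have [n01 n02 n03] : [/\ o0 != o1, o0 != o2 & o0 != o3] by [].
have [n12 n13 n23] : [/\ o1 != o2, o1 != o3 & o2 != o3] by [].
clearbody o3 o2 o1 o0.
rewrite !tperm1 !perm1 !tpermR.
rewrite (tpermD n02 n12) (tpermD n03 n13) (tpermD n01 _) 1?eq_sym//.
rewrite (tpermD n03 n23) (tpermD n01 _) 1?eq_sym// (tpermD n02 _) 1?eq_sym//.
rewrite c0 c1 c2 c3 p0 p1 p2 p3.
rewrite !zE !yE !roof_integralZE.
rewrite !(ZrD, ZrM) !Zr_lit.
by rewrite (_ : Pos.to_nat 48 = 48%N)// (_ : Pos.to_nat 2 = 2%N)//; field.
Qed.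

Lemma coverage_beats_sausage (ss : seq (seq nat * seq nat)) (lo hi : Z) :
  coverage lo ss = Some hi ->
  forall n : nat, (lo <= Z.of_nat n)%Z -> (Z.of_nat n < hi)%Z -> beats_sausage R n.
Proof.
elim: ss lo => [|[m t] ss IH] lo /=.
  by move=> [<-] n n1 n2; lia.
case: ifP => // /and4P[/eqP sm /eqP st /roofs_fitP tm vlo] H n nlo nhi.
have [nc|nc] := Z.lt_ge_cases (lattice_countZ m t) (Z.of_nat n).
  by apply: (IH _ H) => //; lia.
apply: (@lattice_beats_sausage R (entry m) (entry t)) => //.
  by rewrite lattice_countZE// in nc; lia.
rewrite roofed_box_boundE//.
have : (1000 * roofed_box_boundZ m t < 8 * 3139 * (Z.of_nat n - 1) * 41 ^ 4)%Z.
  have [] := Z.ltb_lt (1000 * roofed_box_boundZ m t)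
    (8 * 3139 * (lo - 1) * 41 ^ 4)%Z.
  by move: vlo => -> /(_ erefl); lia.
move=> /(@Zr_lt R).
rewrite (_ : (41 ^ 4)%Z = (41 * 41 * 41 * 41)%Z)//.
rewrite !(ZrM, ZrB) !Zr_lit !Zr_nat.
rewrite (_ : Pos.to_nat 41 = 41%N)// (_ : Pos.to_nat 8 = 8%N)// (_ : Pos.to_nat 1 = 1%N)//.
rewrite (_ : Pos.to_nat 1000 = 1000%N)// (_ : Pos.to_nat 3139 = 3139%N)//.
rewrite ltr_pdivrMr; last by lra.
move: (Zr (roofed_box_boundZ m t)) (n%:R) => x y xy; lra.
Qed.

End Coverage.

Section AllCardinals.
Import BinInt.
(* importing [BinInt] gives the key N to binary naturals *)
Delimit Scope nat_scope with N.
Context {R : realType}.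

(** Pairs (m, t), in the order of the intervals of n that they serve. The first
    of these intervals have about a thousand elements, the last ones some
    twenty million: the advantage of the lattice grows like n, its surface cost
    like n ^ (3 / 4). *)
Definition shapes : seq (seq nat * seq nat) :=
  [::
   ([:: 17; 19; 19; 19], [:: 17; 13; 13; 14]); ([:: 18; 18; 19; 19], [:: 13; 17; 14; 14]);
   ([:: 18; 18; 19; 19], [:: 18; 18; 18; 18]); ([:: 17; 17; 20; 21], [:: 8; 8; 13; 14]);
   ([:: 17; 17; 20; 21], [:: 8; 8; 17; 17]); ([:: 16; 19; 20; 20], [:: 12; 8; 7; 13]);
   ([:: 17; 17; 20; 21], [:: 8; 9; 11; 16]); ([:: 17; 17; 20; 21], [:: 8; 13; 8; 15]);
   ([:: 17; 17; 20; 21], [:: 8; 9; 16; 14]); ([:: 17; 17; 20; 21], [:: 8; 10; 15; 11]);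
   ([:: 17; 17; 20; 21], [:: 9; 11; 9; 12]); ([:: 17; 17; 20; 21], [:: 9; 14; 8; 17]);
   ([:: 17; 17; 20; 21], [:: 9; 17; 17; 8]); ([:: 17; 17; 20; 21], [:: 8; 14; 15; 11]);
   ([:: 17; 17; 20; 21], [:: 8; 14; 14; 14]); ([:: 17; 17; 20; 21], [:: 15; 16; 10; 8]);
   ([:: 17; 17; 20; 21], [:: 9; 13; 17; 14]); ([:: 17; 17; 20; 21], [:: 16; 16; 15; 8]);
   ([:: 17; 17; 20; 21], [:: 10; 17; 16; 14]); ([:: 17; 17; 20; 21], [:: 11; 17; 15; 17]);
   ([:: 17; 17; 20; 21], [:: 16; 17; 12; 16]); ([:: 16; 19; 20; 20], [:: 17; 15; 16; 16]);
   ([:: 17; 18; 19; 21], [:: 17; 15; 16; 16]); ([:: 17; 19; 19; 20], [:: 19; 17; 17; 12]);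
   ([:: 18; 18; 19; 20], [:: 16; 18; 18; 13]); ([:: 18; 19; 19; 19], [:: 19; 18; 18; 18]);
   ([:: 17; 17; 21; 21], [:: 8; 17; 8; 14]); ([:: 17; 17; 21; 21], [:: 8; 16; 10; 10]);
   ([:: 17; 17; 21; 21], [:: 8; 17; 9; 16]); ([:: 17; 17; 21; 21], [:: 8; 14; 11; 12]);
   ([:: 17; 17; 21; 21], [:: 8; 17; 11; 17]); ([:: 17; 17; 21; 21], [:: 8; 17; 15; 15]);
   ([:: 17; 17; 21; 21], [:: 9; 17; 11; 17]); ([:: 17; 17; 21; 21], [:: 14; 16; 8; 15]);
   ([:: 17; 17; 21; 21], [:: 17; 17; 9; 12]); ([:: 17; 17; 21; 21], [:: 11; 16; 15; 15]);
   ([:: 17; 17; 21; 21], [:: 17; 17; 12; 14]); ([:: 16; 20; 20; 20], [:: 14; 13; 15; 16]);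
   ([:: 18; 18; 18; 22], [:: 15; 16; 16; 18]); ([:: 17; 19; 19; 21], [:: 15; 15; 17; 17]);
   ([:: 18; 18; 20; 20], [:: 13; 17; 15; 17]); ([:: 18; 19; 19; 20], [:: 15; 18; 18; 18]);
   ([:: 19; 19; 19; 19], [:: 19; 19; 19; 19]); ([:: 17; 18; 21; 21], [:: 9; 8; 13; 16]);
   ([:: 17; 18; 21; 21], [:: 9; 17; 8; 11]); ([:: 17; 18; 21; 21], [:: 9; 9; 13; 15]);
   ([:: 17; 18; 21; 21], [:: 17; 9; 8; 17]); ([:: 17; 18; 21; 21], [:: 12; 8; 15; 16]);
   ([:: 17; 18; 21; 21], [:: 15; 8; 15; 15]); ([:: 17; 18; 21; 21], [:: 9; 15; 16; 16]);
   ([:: 17; 18; 21; 21], [:: 10; 16; 13; 17]); ([:: 17; 18; 21; 21], [:: 11; 17; 15; 15]);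
   ([:: 17; 18; 21; 21], [:: 13; 17; 17; 17]); ([:: 18; 18; 19; 22], [:: 18; 18; 15; 13]);
   ([:: 17; 20; 20; 20], [:: 15; 17; 17; 17]); ([:: 18; 19; 20; 20], [:: 16; 17; 13; 18]);
   ([:: 19; 19; 19; 20], [:: 19; 19; 19; 19]); ([:: 17; 19; 21; 21], [:: 17; 8; 9; 9]);
   ([:: 17; 19; 21; 21], [:: 14; 8; 8; 14]); ([:: 17; 19; 21; 21], [:: 13; 9; 8; 13]);
   ([:: 17; 19; 21; 21], [:: 10; 16; 8; 13]); ([:: 17; 19; 21; 21], [:: 16; 10; 8; 14]);
   ([:: 17; 19; 21; 21], [:: 14; 8; 16; 17]); ([:: 17; 19; 21; 21], [:: 18; 17; 8; 14]);
   ([:: 17; 19; 21; 21], [:: 19; 15; 9; 17]); ([:: 17; 19; 21; 21], [:: 15; 16; 11; 17]);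
   ([:: 18; 18; 20; 22], [:: 16; 17; 18; 17]); ([:: 18; 19; 20; 21], [:: 13; 17; 17; 17]);
   ([:: 19; 19; 19; 21], [:: 19; 19; 19; 19]); ([:: 18; 18; 21; 22], [:: 10; 11; 9; 9]);
   ([:: 17; 20; 21; 21], [:: 11; 8; 9; 17]); ([:: 18; 18; 21; 22], [:: 9; 12; 9; 16]);
   ([:: 18; 18; 21; 22], [:: 9; 17; 9; 15]); ([:: 18; 18; 21; 22], [:: 9; 18; 17; 10]);
   ([:: 18; 18; 21; 22], [:: 9; 14; 16; 18]); ([:: 18; 18; 21; 22], [:: 15; 17; 9; 15]);
   ([:: 18; 18; 21; 22], [:: 12; 16; 17; 13]); ([:: 18; 18; 21; 22], [:: 18; 18; 18; 18]);
   ([:: 18; 19; 21; 21], [:: 18; 16; 13; 17]); ([:: 19; 19; 20; 21], [:: 17; 18; 14; 18]);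
   ([:: 18; 18; 22; 22], [:: 9; 13; 9; 11]); ([:: 18; 18; 22; 22], [:: 9; 10; 13; 15]);
   ([:: 18; 18; 22; 22], [:: 9; 18; 10; 13]); ([:: 18; 18; 22; 22], [:: 9; 13; 16; 16]);
   ([:: 18; 18; 22; 22], [:: 17; 17; 10; 10]); ([:: 18; 18; 22; 22], [:: 16; 18; 10; 14]);
   ([:: 18; 18; 22; 22], [:: 18; 18; 14; 14]); ([:: 19; 19; 19; 23], [:: 16; 17; 17; 14]);
   ([:: 18; 20; 21; 21], [:: 17; 17; 14; 17]); ([:: 19; 20; 20; 21], [:: 20; 19; 19; 19]);
   ([:: 18; 19; 22; 22], [:: 10; 18; 9; 9]); ([:: 18; 19; 22; 22], [:: 16; 10; 9; 10]);
   ([:: 18; 19; 22; 22], [:: 11; 9; 15; 18]); ([:: 18; 19; 22; 22], [:: 18; 18; 9; 10]);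
   ([:: 18; 19; 22; 22], [:: 17; 15; 9; 15]); ([:: 18; 19; 22; 22], [:: 12; 18; 18; 18]);
   ([:: 19; 19; 20; 23], [:: 14; 18; 16; 17]); ([:: 19; 20; 20; 22], [:: 17; 18; 19; 13]);
   ([:: 20; 20; 20; 21], [:: 20; 20; 20; 20]); ([:: 19; 19; 21; 23], [:: 10; 10; 11; 11]);
   ([:: 18; 20; 22; 22], [:: 18; 9; 9; 13]); ([:: 18; 20; 22; 22], [:: 11; 15; 9; 16]);
   ([:: 18; 20; 22; 22], [:: 17; 9; 14; 18]); ([:: 18; 20; 22; 22], [:: 17; 18; 10; 15]);
   ([:: 18; 20; 22; 22], [:: 18; 16; 14; 18]); ([:: 19; 20; 21; 22], [:: 20; 14; 19; 19]);
   ([:: 20; 20; 21; 21], [:: 20; 20; 20; 20]); ([:: 18; 21; 22; 22], [:: 12; 9; 9; 18]);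
   ([:: 19; 19; 22; 23], [:: 10; 10; 19; 15]); ([:: 19; 19; 22; 23], [:: 10; 16; 11; 19]);
   ([:: 19; 19; 22; 23], [:: 18; 18; 12; 10]); ([:: 19; 19; 22; 23], [:: 17; 19; 12; 17]);
   ([:: 19; 20; 21; 23], [:: 16; 19; 19; 16]); ([:: 20; 21; 21; 21], [:: 16; 14; 20; 20]);
   ([:: 19; 19; 23; 23], [:: 10; 10; 14; 14]); ([:: 19; 19; 23; 23], [:: 10; 17; 10; 17]);
   ([:: 19; 19; 23; 23], [:: 10; 18; 15; 15]); ([:: 19; 19; 23; 23], [:: 12; 18; 16; 19]);
   ([:: 18; 22; 22; 22], [:: 17; 14; 16; 18]); ([:: 19; 21; 22; 22], [:: 20; 15; 16; 18]);
   ([:: 21; 21; 21; 21], [:: 21; 21; 21; 21]); ([:: 19; 20; 23; 23], [:: 11; 19; 10; 10]);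
   ([:: 19; 20; 23; 23], [:: 16; 10; 11; 14]); ([:: 19; 20; 23; 23], [:: 17; 10; 19; 19]);
   ([:: 19; 20; 23; 23], [:: 19; 19; 12; 16]); ([:: 19; 22; 22; 22], [:: 22; 14; 16; 18]);
   ([:: 21; 21; 21; 22], [:: 19; 19; 21; 17]); ([:: 19; 21; 23; 23], [:: 12; 10; 11; 12]);
   ([:: 19; 21; 23; 23], [:: 16; 12; 10; 11]); ([:: 19; 21; 23; 23], [:: 19; 10; 13; 18]);
   ([:: 19; 21; 23; 23], [:: 19; 12; 17; 19]); ([:: 20; 21; 22; 23], [:: 19; 18; 13; 18]);
   ([:: 21; 21; 22; 22], [:: 21; 21; 21; 21]); ([:: 20; 20; 23; 24], [:: 11; 11; 15; 11]);
   ([:: 20; 20; 23; 24], [:: 11; 14; 20; 11]); ([:: 20; 20; 23; 24], [:: 11; 17; 19; 19]);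
   ([:: 20; 20; 23; 24], [:: 19; 19; 15; 19]); ([:: 21; 21; 22; 23], [:: 15; 17; 18; 21]);
   ([:: 20; 20; 24; 24], [:: 11; 11; 12; 14]); ([:: 20; 20; 24; 24], [:: 11; 13; 13; 16]);
   ([:: 20; 20; 24; 24], [:: 18; 20; 11; 13]); ([:: 20; 20; 24; 24], [:: 20; 20; 20; 20]);
   ([:: 20; 22; 23; 23], [:: 22; 20; 17; 19]); ([:: 20; 21; 24; 24], [:: 12; 11; 11; 11]);
   ([:: 20; 21; 24; 24], [:: 12; 11; 12; 15]); ([:: 20; 21; 24; 24], [:: 14; 11; 15; 17]);
   ([:: 20; 21; 24; 24], [:: 18; 20; 12; 19]); ([:: 20; 23; 23; 23], [:: 23; 16; 18; 19]);
   ([:: 22; 22; 22; 23], [:: 22; 22; 22; 22]); ([:: 20; 22; 24; 24], [:: 13; 13; 11; 11]);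
   ([:: 20; 22; 24; 24], [:: 14; 12; 12; 16]); ([:: 20; 22; 24; 24], [:: 22; 12; 18; 19]);
   ([:: 21; 22; 23; 24], [:: 15; 20; 21; 20]); ([:: 22; 22; 23; 23], [:: 22; 22; 22; 22]);
   ([:: 21; 21; 24; 25], [:: 12; 12; 14; 12]); ([:: 21; 21; 24; 25], [:: 12; 14; 21; 14]);
   ([:: 21; 21; 24; 25], [:: 20; 20; 19; 13]); ([:: 21; 23; 23; 24], [:: 21; 20; 20; 20]);
   ([:: 20; 24; 24; 24], [:: 17; 11; 11; 11]); ([:: 21; 21; 25; 25], [:: 13; 19; 12; 14]);
   ([:: 21; 21; 25; 25], [:: 15; 18; 19; 21]); ([:: 21; 23; 24; 24], [:: 23; 20; 16; 20]);
   ([:: 23; 23; 23; 23], [:: 23; 23; 23; 23]); ([:: 21; 22; 25; 25], [:: 13; 12; 12; 17]);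
   ([:: 21; 22; 25; 25], [:: 14; 21; 12; 19]); ([:: 22; 22; 23; 26], [:: 21; 22; 21; 15]);
   ([:: 23; 23; 23; 24], [:: 23; 23; 23; 23]); ([:: 21; 23; 25; 25], [:: 16; 12; 12; 12]);
   ([:: 21; 23; 25; 25], [:: 14; 20; 12; 18]); ([:: 21; 23; 25; 25], [:: 23; 21; 19; 21]);
   ([:: 23; 23; 24; 24], [:: 23; 23; 23; 23]); ([:: 22; 22; 25; 26], [:: 13; 13; 14; 13]);
   ([:: 22; 22; 25; 26], [:: 13; 22; 22; 14]); ([:: 22; 23; 24; 26], [:: 22; 19; 17; 21]);
   ([:: 24; 24; 24; 24], [:: 8; 12; 14; 20]); ([:: 22; 22; 26; 26], [:: 13; 13; 19; 19]);
   ([:: 22; 22; 26; 26], [:: 16; 19; 22; 22]); ([:: 23; 23; 25; 25], [:: 22; 22; 20; 21]);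
   ([:: 22; 23; 26; 26], [:: 14; 13; 13; 13]); ([:: 22; 23; 26; 26], [:: 21; 13; 14; 19]);
   ([:: 22; 24; 25; 26], [:: 18; 21; 22; 21]); ([:: 24; 24; 24; 26], [:: 10; 10; 18; 20]);
   ([:: 23; 23; 25; 27], [:: 14; 14; 15; 14]); ([:: 22; 24; 26; 26], [:: 22; 21; 14; 21]);
   ([:: 24; 24; 25; 25], [:: 24; 24; 24; 24]); ([:: 24; 24; 24; 27], [:: 20; 22; 24; 8]);
   ([:: 23; 23; 26; 27], [:: 17; 22; 14; 21]); ([:: 24; 24; 25; 26], [:: 24; 24; 23; 20]);
   ([:: 23; 23; 27; 27], [:: 14; 14; 14; 17]); ([:: 23; 23; 27; 27], [:: 17; 17; 21; 21]);
   ([:: 24; 25; 25; 26], [:: 25; 18; 24; 24]); ([:: 23; 24; 27; 27], [:: 15; 14; 14; 14]);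
   ([:: 23; 24; 27; 27], [:: 15; 21; 18; 22]); ([:: 25; 25; 25; 26], [:: 19; 23; 23; 21]);
   ([:: 24; 24; 27; 27], [:: 10; 23; 22; 24]); ([:: 23; 25; 27; 27], [:: 23; 22; 14; 22]);
   ([:: 24; 25; 27; 27], [:: 9; 14; 20; 24]); ([:: 25; 25; 25; 28], [:: 21; 21; 23; 9]);
   ([:: 23; 26; 27; 27], [:: 26; 16; 22; 22]); ([:: 24; 26; 27; 27], [:: 22; 8; 18; 24]);
   ([:: 23; 27; 27; 27], [:: 21; 14; 14; 17]); ([:: 25; 25; 26; 28], [:: 17; 23; 21; 23]);
   ([:: 25; 25; 27; 28], [:: 21; 25; 15; 9]); ([:: 25; 25; 27; 28], [:: 13; 24; 25; 17]);
   ([:: 26; 26; 26; 27], [:: 24; 24; 25; 20]); ([:: 25; 25; 28; 28], [:: 11; 21; 25; 25]);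
   ([:: 25; 25; 28; 28], [:: 19; 25; 19; 19]); ([:: 25; 26; 28; 28], [:: 24; 9; 23; 23]);
   ([:: 25; 26; 28; 28], [:: 22; 13; 19; 19]); ([:: 26; 27; 27; 27], [:: 27; 24; 24; 25]);
   ([:: 26; 26; 28; 28], [:: 22; 22; 10; 24]); ([:: 25; 27; 28; 28], [:: 23; 25; 17; 25]);
   ([:: 26; 26; 28; 29], [:: 10; 26; 22; 22]); ([:: 25; 28; 28; 28], [:: 28; 15; 17; 25]);
   ([:: 26; 26; 29; 29], [:: 10; 25; 18; 18]); ([:: 26; 27; 28; 29], [:: 25; 12; 24; 26]);
   ([:: 27; 27; 28; 28], [:: 27; 27; 27; 27]); ([:: 26; 27; 29; 29], [:: 13; 26; 16; 24]);
   ([:: 26; 28; 28; 29], [:: 26; 24; 25; 20]); ([:: 27; 27; 28; 30], [:: 11; 23; 23; 27]);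
   ([:: 26; 28; 29; 29], [:: 24; 18; 22; 24]); ([:: 27; 27; 29; 30], [:: 11; 21; 27; 21]);
   ([:: 27; 27; 29; 30], [:: 17; 23; 27; 23]); ([:: 27; 27; 30; 30], [:: 17; 25; 11; 21]);
   ([:: 27; 27; 30; 30], [:: 17; 27; 27; 27]); ([:: 27; 28; 30; 30], [:: 27; 11; 17; 23]);
   ([:: 28; 28; 28; 31], [:: 18; 20; 26; 18]); ([:: 28; 28; 29; 31], [:: 24; 28; 10; 28]);
   ([:: 28; 28; 29; 31], [:: 16; 22; 26; 27]); ([:: 28; 28; 30; 31], [:: 22; 26; 22; 10]);
   ([:: 28; 28; 30; 31], [:: 24; 28; 24; 16]); ([:: 28; 28; 31; 31], [:: 12; 20; 24; 24]);
   ([:: 28; 28; 31; 31], [:: 20; 28; 24; 28]); ([:: 28; 29; 31; 31], [:: 21; 12; 27; 27]);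
   ([:: 29; 29; 29; 32], [:: 23; 29; 29; 29]); ([:: 28; 30; 31; 31], [:: 30; 28; 12; 28]);
   ([:: 30; 30; 30; 30], [:: 26; 26; 26; 26]); ([:: 29; 29; 31; 32], [:: 19; 27; 15; 28]);
   ([:: 29; 29; 32; 32], [:: 11; 25; 29; 29]); ([:: 29; 29; 32; 32], [:: 19; 27; 21; 21]);
   ([:: 29; 31; 31; 32], [:: 23; 27; 27; 11]); ([:: 29; 30; 32; 32], [:: 24; 27; 23; 29]);
   ([:: 29; 31; 32; 32], [:: 31; 23; 13; 29]); ([:: 30; 30; 32; 33], [:: 14; 14; 24; 28]);
   ([:: 30; 30; 32; 33], [:: 29; 30; 16; 22]); ([:: 30; 30; 33; 33], [:: 14; 18; 28; 28]);
   ([:: 30; 31; 32; 33], [:: 27; 30; 22; 30]); ([:: 30; 31; 33; 33], [:: 27; 28; 14; 26]);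
   ([:: 30; 32; 33; 33], [:: 24; 28; 12; 18]); ([:: 31; 31; 32; 34], [:: 27; 27; 19; 31]);
   ([:: 31; 31; 33; 34], [:: 15; 29; 23; 21]); ([:: 31; 31; 34; 34], [:: 13; 19; 23; 27]);
   ([:: 31; 31; 34; 34], [:: 27; 29; 19; 29]); ([:: 32; 32; 32; 35], [:: 14; 31; 32; 30]);
   ([:: 32; 32; 33; 35], [:: 14; 26; 16; 32]); ([:: 31; 33; 34; 34], [:: 33; 27; 19; 31]);
   ([:: 31; 34; 34; 34], [:: 24; 15; 25; 29]); ([:: 32; 32; 35; 35], [:: 14; 22; 22; 24]);
   ([:: 32; 33; 34; 35], [:: 29; 24; 26; 28]); ([:: 33; 33; 33; 36], [:: 17; 27; 27; 33]);
   ([:: 32; 34; 35; 35], [:: 22; 32; 14; 32]); ([:: 33; 33; 35; 36], [:: 25; 29; 15; 15]);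
   ([:: 32; 35; 35; 35], [:: 25; 22; 28; 30]); ([:: 33; 33; 36; 36], [:: 25; 29; 17; 25]);
   ([:: 33; 34; 36; 36], [:: 22; 15; 29; 29]); ([:: 34; 34; 36; 36], [:: 16; 30; 16; 22]);
   ([:: 34; 34; 35; 37], [:: 33; 34; 28; 22]); ([:: 34; 34; 36; 37], [:: 32; 32; 24; 18]);
   ([:: 34; 34; 37; 37], [:: 26; 32; 16; 24]); ([:: 34; 35; 37; 37], [:: 35; 26; 16; 18]);
   ([:: 35; 35; 36; 38], [:: 19; 23; 19; 17]); ([:: 35; 35; 36; 38], [:: 35; 35; 23; 31]);
   ([:: 35; 35; 37; 38], [:: 33; 35; 27; 19]); ([:: 35; 35; 38; 38], [:: 29; 34; 17; 35]);
   ([:: 35; 36; 38; 38], [:: 18; 21; 33; 34]); ([:: 36; 36; 37; 39], [:: 18; 32; 18; 30]);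
   ([:: 35; 38; 38; 38], [:: 28; 17; 17; 34]); ([:: 36; 37; 38; 38], [:: 31; 35; 34; 34]);
   ([:: 36; 36; 39; 39], [:: 30; 36; 30; 30]); ([:: 36; 37; 39; 39], [:: 31; 36; 22; 35]);
   ([:: 36; 38; 39; 39], [:: 34; 34; 20; 32]); ([:: 37; 37; 39; 40], [:: 33; 37; 19; 37]);
   ([:: 37; 37; 40; 40], [:: 23; 37; 21; 33]); ([:: 37; 38; 40; 40], [:: 26; 19; 33; 35]);
   ([:: 37; 39; 40; 40], [:: 21; 33; 21; 33]); ([:: 38; 38; 40; 41], [:: 20; 32; 22; 30]);
   ([:: 38; 38; 41; 41], [:: 20; 26; 24; 38]); ([:: 38; 39; 41; 41], [:: 27; 22; 20; 36]);
   ([:: 38; 40; 41; 41], [:: 22; 20; 30; 34]); ([:: 38; 41; 41; 41], [:: 25; 20; 24; 37]);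
   ([:: 39; 39; 42; 42], [:: 21; 25; 25; 33]); ([:: 39; 40; 42; 42], [:: 34; 21; 23; 27]);
   ([:: 39; 41; 42; 42], [:: 23; 39; 21; 33]); ([:: 40; 40; 42; 43], [:: 22; 24; 34; 36]);
   ([:: 40; 40; 43; 43], [:: 22; 28; 32; 36]); ([:: 40; 41; 43; 43], [:: 29; 40; 22; 32]);
   ([:: 40; 42; 43; 43], [:: 24; 39; 32; 34]); ([:: 40; 43; 43; 43], [:: 27; 36; 36; 38]);
   ([:: 41; 42; 43; 44], [:: 38; 33; 37; 37]); ([:: 41; 43; 44; 44], [:: 27; 23; 23; 23]);
   ([:: 41; 44; 44; 44], [:: 30; 23; 23; 25]); ([:: 42; 42; 45; 45], [:: 26; 38; 24; 24]);
   ([:: 42; 43; 45; 45], [:: 27; 24; 30; 36]); ([:: 42; 44; 45; 45], [:: 44; 24; 32; 38]);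
   ([:: 42; 45; 45; 45], [:: 31; 36; 42; 42]); ([:: 44; 44; 45; 45], [:: 44; 44; 44; 44]);
   ([:: 43; 45; 46; 46], [:: 31; 25; 25; 25]); ([:: 44; 44; 46; 47], [:: 26; 26; 30; 44]);
   ([:: 44; 44; 47; 47], [:: 26; 40; 44; 44]); ([:: 45; 45; 46; 47], [:: 35; 45; 45; 44]);
   ([:: 44; 47; 47; 47], [:: 29; 26; 26; 28]); ([:: 45; 45; 48; 48], [:: 27; 45; 27; 35]);
   ([:: 46; 46; 46; 49], [:: 30; 40; 40; 46]); ([:: 47; 47; 47; 47], [:: 47; 47; 47; 47]);
   ([:: 46; 47; 48; 49], [:: 29; 30; 28; 28]); ([:: 46; 47; 49; 49], [:: 29; 32; 46; 46]);
   ([:: 48; 48; 48; 49], [:: 27; 27; 27; 27]); ([:: 48; 48; 48; 50], [:: 27; 27; 45; 33]);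
   ([:: 47; 48; 50; 50], [:: 40; 45; 31; 37]); ([:: 48; 49; 50; 50], [:: 28; 39; 27; 27]);
   ([:: 49; 49; 49; 51], [:: 31; 43; 46; 28]); ([:: 49; 50; 50; 51], [:: 29; 28; 28; 28]);
   ([:: 49; 50; 51; 51], [:: 29; 40; 28; 43]); ([:: 50; 50; 50; 52], [:: 44; 50; 50; 44]);
   ([:: 50; 50; 52; 52], [:: 32; 32; 29; 44]); ([:: 51; 51; 51; 52], [:: 42; 42; 48; 48]);
   ([:: 51; 51; 52; 53], [:: 30; 30; 45; 39]); ([:: 52; 52; 52; 52], [:: 52; 52; 52; 52]);
   ([:: 52; 52; 52; 54], [:: 31; 31; 49; 43]); ([:: 52; 52; 54; 54], [:: 31; 31; 31; 31]);
   ([:: 52; 53; 54; 54], [:: 32; 40; 40; 52]); ([:: 53; 53; 54; 55], [:: 32; 35; 32; 32]);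
   ([:: 53; 53; 55; 55], [:: 47; 53; 41; 47]); ([:: 54; 54; 54; 56], [:: 33; 42; 42; 33]);
   ([:: 54; 54; 56; 56], [:: 33; 33; 33; 33]); ([:: 54; 55; 56; 56], [:: 49; 45; 39; 54]);
   ([:: 55; 55; 56; 57], [:: 34; 46; 34; 55]); ([:: 55; 56; 57; 57], [:: 35; 34; 34; 34]);
   ([:: 56; 56; 57; 57], [:: 56; 56; 56; 56]); ([:: 56; 56; 58; 58], [:: 38; 38; 50; 56]);
   ([:: 57; 57; 58; 58], [:: 36; 57; 36; 36]); ([:: 57; 57; 59; 59], [:: 36; 36; 36; 36]);
   ([:: 58; 58; 58; 59], [:: 58; 58; 58; 58]); ([:: 58; 58; 59; 60], [:: 43; 49; 40; 58]);
   ([:: 58; 59; 60; 60], [:: 56; 37; 40; 46]); ([:: 59; 59; 60; 61], [:: 38; 41; 47; 38]);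
   ([:: 59; 60; 61; 61], [:: 39; 38; 38; 44]); ([:: 60; 60; 61; 61], [:: 60; 60; 60; 60]);
   ([:: 60; 60; 62; 62], [:: 54; 60; 48; 54]); ([:: 60; 62; 62; 62], [:: 47; 48; 57; 60]);
   ([:: 61; 61; 63; 63], [:: 46; 58; 58; 61]); ([:: 62; 62; 62; 64], [:: 50; 53; 53; 56]);
   ([:: 63; 63; 63; 63], [:: 57; 57; 57; 63]); ([:: 63; 63; 64; 64], [:: 63; 63; 63; 63]);
   ([:: 64; 64; 64; 64], [:: 64; 64; 64; 64]); ([:: 64; 64; 65; 65], [:: 64; 64; 64; 64]);
   ([:: 65; 65; 65; 65], [:: 65; 65; 65; 65]); ([:: 65; 65; 66; 66], [:: 65; 65; 65; 65]);
   ([:: 66; 66; 66; 66], [:: 66; 66; 66; 66]); ([:: 66; 66; 67; 67], [:: 66; 66; 66; 66]);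
   ([:: 67; 67; 67; 67], [:: 67; 67; 67; 67]); ([:: 67; 67; 68; 68], [:: 67; 67; 67; 67]);
   ([:: 68; 68; 68; 68], [:: 68; 68; 68; 68]); ([:: 68; 68; 69; 69], [:: 68; 68; 68; 68]);
   ([:: 69; 69; 69; 69], [:: 69; 69; 69; 69]); ([:: 69; 69; 70; 70], [:: 69; 69; 69; 69]);
   ([:: 70; 70; 70; 70], [:: 70; 70; 70; 70]); ([:: 70; 70; 71; 71], [:: 70; 70; 70; 70]);
   ([:: 71; 71; 71; 71], [:: 71; 71; 71; 71]); ([:: 71; 71; 72; 72], [:: 71; 71; 71; 71]);
   ([:: 72; 72; 72; 72], [:: 72; 72; 72; 72]); ([:: 72; 72; 73; 73], [:: 72; 72; 72; 72]);
   ([:: 73; 73; 73; 73], [:: 73; 73; 73; 73]); ([:: 73; 73; 74; 74], [:: 73; 73; 73; 73]);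
   ([:: 74; 74; 74; 74], [:: 74; 74; 74; 74]); ([:: 74; 75; 75; 75], [:: 51; 50; 50; 50]);
   ([:: 75; 75; 75; 76], [:: 75; 75; 75; 75]); ([:: 76; 76; 76; 76], [:: 52; 52; 52; 52]);
   ([:: 76; 76; 77; 77], [:: 76; 76; 76; 76]); ([:: 77; 77; 77; 78], [:: 53; 53; 57; 53]);
   ([:: 77; 78; 78; 78], [:: 78; 77; 77; 77]); ([:: 78; 78; 79; 79], [:: 58; 62; 54; 54]);
   ([:: 79; 79; 79; 79], [:: 79; 79; 79; 79]); ([:: 79; 80; 80; 80], [:: 68; 55; 55; 71]);
   ([:: 80; 80; 80; 81], [:: 80; 80; 80; 80]); ([:: 81; 81; 81; 81], [:: 57; 61; 65; 65]);
   ([:: 81; 82; 82; 82], [:: 70; 57; 57; 57]); ([:: 82; 82; 82; 83], [:: 82; 82; 82; 82]);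
   ([:: 83; 83; 83; 83], [:: 63; 67; 71; 75]); ([:: 83; 84; 84; 84], [:: 84; 63; 67; 67]);
   ([:: 84; 84; 85; 85], [:: 64; 68; 72; 76]); ([:: 85; 85; 85; 86], [:: 73; 85; 85; 69]);
   ([:: 86; 86; 86; 86], [:: 86; 86; 86; 86]); ([:: 86; 87; 87; 87], [:: 87; 86; 86; 86]);
   ([:: 87; 87; 88; 88], [:: 87; 87; 87; 87]); ([:: 88; 88; 88; 89], [:: 88; 88; 88; 88]);
   ([:: 89; 89; 89; 89], [:: 89; 89; 89; 89]); ([:: 89; 90; 90; 90], [:: 90; 89; 89; 89]);
   ([:: 90; 90; 91; 91], [:: 90; 90; 90; 90]); ([:: 91; 91; 91; 92], [:: 91; 91; 91; 91]);
   ([:: 92; 92; 92; 92], [:: 92; 92; 92; 92]); ([:: 92; 93; 93; 93], [:: 93; 92; 92; 92]);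
   ([:: 93; 93; 94; 94], [:: 93; 93; 93; 93]); ([:: 94; 94; 94; 95], [:: 94; 94; 94; 94]);
   ([:: 95; 95; 95; 95], [:: 95; 95; 95; 95]); ([:: 95; 96; 96; 96], [:: 96; 95; 95; 95]);
   ([:: 96; 96; 97; 97], [:: 96; 96; 96; 96]); ([:: 97; 97; 97; 98], [:: 97; 97; 97; 97]);
   ([:: 98; 98; 98; 98], [:: 98; 98; 98; 98]); ([:: 98; 99; 99; 99], [:: 99; 98; 98; 98]);
   ([:: 99; 99; 100; 100], [:: 99; 99; 99; 99]); ([:: 100; 100; 100; 101], [:: 100; 100; 100; 100]);
   ([:: 101; 101; 101; 101], [:: 101; 101; 101; 101]); ([:: 101; 102; 102; 102], [:: 102; 101; 101; 101]);
   ([:: 102; 103; 103; 103], [:: 79; 78; 78; 78]); ([:: 103; 103; 104; 104], [:: 103; 103; 103; 103]);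
   ([:: 104; 104; 105; 105], [:: 80; 80; 92; 104]); ([:: 105; 105; 106; 106], [:: 81; 85; 81; 81]);
   ([:: 106; 106; 107; 107], [:: 82; 82; 82; 82]); ([:: 107; 107; 108; 108], [:: 83; 107; 83; 83]);
   ([:: 108; 108; 109; 109], [:: 88; 108; 96; 100]); ([:: 109; 109; 110; 110], [:: 109; 109; 109; 109]);
   ([:: 110; 110; 111; 111], [:: 110; 110; 110; 110])]%N.

Lemma coverage_shapes :
  coverage 516946 shapes = Some 607228165%Z.
Proof. by vm_compute. Qed.

Lemma roof_count_diag k : (4 * roof_count k k k k)%N = ((k * k.+1) ^ 2)%N.
Proof.
elim: k => [|k IH]; first by rewrite /roof_count big_ord0.
rewrite /roof_count big_ord_recl subn0 mulnDr.
rewrite (_ : \sum_(s < k) _ = roof_count k k k k)%N; last first.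
  by apply: eq_bigr => s _; rewrite /= /bump /= add1n subSS.
by rewrite IH; lia.
Qed.

(** The number of lattice points in a regular 24-cell. *)
Lemma lattice_count_diag k :
  lattice_count (fun=> k) (fun=> k) =
    ((2 * (k * k) + 2 * k + 1) * (2 * (k * k) + 2 * k + 1))%N.
Proof.
have E : entry [:: k; k; k; k] = (fun=> k).
  by apply/funext => -[[|[|[|[|]]]]].
rewrite -{1}E -E lattice_countE; have := roof_count_diag k.
by move: (roof_count _ _ _ _) => x; rewrite /muln_rec; nia.
Qed.

(** The parallel 24-cell has volume 32 (k + rho) ^ 4, from which the small tips
    cut off at its eight vertices on the axes are subtracted. *)
Lemma roofed_box_bound_diag_le k (rho : R) :
  roofed_box_bound (fun=> k) (fun=> k) rho <= 32 * (k%:R + rho) ^+ 4.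
Proof.
rewrite /roofed_box_bound !sumr_const !prodr_const !card_ord /roof_integral.
set M := k%:R + rho.
have -> : k%:R + 1 - rho = M - (2 * rho - 1) by rewrite /M; ring.
have : 0 <= (2 * rho - 1) ^+ 4 by rewrite exprn_even_ge0.
move: (2 * rho - 1) => e e4.
rewrite [X in X <= _](_ : _ = 32 * M ^+ 4 - 16 * e ^+ 4); last by field.
lra.
Qed.

(** Take the smallest 24-cell with at least n points. It contains the points of
    the next smaller one, of which there are less than n; so the inequality is
    between 32 (k + rho) ^ 4 and 8 / 3 * 3.139 * (2 (k - 1)^2 + 2 (k - 1) + 1)
    ^ 2, whose leading coefficient is larger than 33. *)
Lemma large_beats_sausage n : (607228165 <= Z.of_nat n)%Z -> beats_sausage R n.
Proof.
move=> nlo.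
pose N k := ((2 * (k * k) + 2 * k + 1) * (2 * (k * k) + 2 * k + 1))%N.
have [j [j110 jn nj]] : exists j, [/\ (110 <= j)%N, (N j < n)%N & (n <= N j.+1)%N].
  have ex : exists k, (n <= N k)%N by exists n; rewrite /N; nia.
  have := ex_minnP ex => -[k nk kmin].
  have k111 : (110 < k)%N.
    rewrite ltnNge; apply/negP => k110.
    have Nk : (Z.of_nat (N k) <= 24421 * 24421)%Z.
      have : (Z.of_nat (2 * (k * k) + 2 * k + 1) <= 24421)%Z by nia.
      by rewrite /N; move: (2 * (k * k) + 2 * k + 1)%N => u; nia.
    lia.
  case: k => [|j] // in nk kmin k111 *; exists j; split=> //.
  by rewrite ltnNge; apply/negP => /kmin; rewrite ltnn.
apply: (@lattice_beats_sausage R (fun=> j.+1) (fun=> j.+1)) => //.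
  by rewrite lattice_count_diag.
apply: le_lt_trans (roofed_box_bound_diag_le _ _) _.
have jR : 110 <= j%:R :> R by rewrite ler_nat.
have nR : (2 * j%:R ^+ 2 + 2 * j%:R + 1) ^+ 2 + 1 <= n%:R :> R.
  by move: jn; rewrite /N -(ler_nat R) -natr1 !(natrD, natrM); lra.
apply: (@lt_le_trans _ _ (8 / 3 * 3139 / 1000 * (2 * j%:R ^+ 2 + 2 * j%:R + 1) ^+ 2)).
  rewrite -(natr1 j); move: (j%:R) jR => x x110.
  (* 978 / 1000 is just above the square root of 32 / (32 / 3 * 3139 / 1000) *)
  have qa : 978 / 1000 * (x + 1 + 29 / 41) ^+ 2 <= x ^+ 2 + x by nra.
  have q0 : 0 <= (x + 1 + 29 / 41) ^+ 2 by rewrite sqr_ge0.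
  have -> : (x + 1 + 29 / 41) ^+ 4 = ((x + 1 + 29 / 41) ^+ 2) ^+ 2.
    by rewrite -exprM.
  move: ((x + 1 + 29 / 41) ^+ 2) qa q0 => a qa q0.
  have -> : 2 * x ^+ 2 + 2 * x + 1 = 2 * (x ^+ 2 + x) + 1 by ring.
  have : 0 <= x ^+ 2 + x by nra.
  move: (x ^+ 2 + x) qa => b qa b0; nra.
by rewrite ler_pM2l; lra.
Qed.

Lemma beats_sausage_Z n : (516946 <= Z.of_nat n)%Z -> beats_sausage R n.
Proof.
move=> nlo; have [h|h] := Z.lt_ge_cases (Z.of_nat n) 607228165%Z.
  exact: (coverage_beats_sausage coverage_shapes).
exact: large_beats_sausage.
Qed.

Lemma beats_sausage_ge n : (516946 <= n)%N -> beats_sausage R n.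
Proof.
have [B BE] : {B | B = 516946%N} by exists 516946%N.
have BZ : Z.of_nat B = 516946%Z by rewrite BE; vm_compute.
by rewrite -BE => Bn; apply: beats_sausage_Z; lia.
Qed.

End AllCardinals.

(** * A lower bound for the area of the unit disc *)

Section DiscArea.
Import BinInt.
(* importing [BinInt] gives the key N to binary naturals *)
Delimit Scope nat_scope with N.

(** 1000 times the largest |x| in the j-th of 2000 cells of [-1, 1]. *)
Definition cell_dist (j : nat) : nat := maxn (1000 - j) (j.+1 - 1000).

(** 10000 times half the chord at distance [cell_dist j / 1000] from the
    centre, rounded down. *)
Definition chordZ (j : nat) : Z :=
  let m := Z.of_nat (cell_dist j) in Z.sqrt (100 * (1000 * 1000 - m * m)).

Fixpoint chord_sumZ (k : nat) : Z :=
  if k is k'.+1 then (chord_sumZ k' + chordZ k')%Z else 0%Z.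

Lemma chord_sumZ_ge : (2 * 1000 * chord_sumZ (1000 + 1000) >= 3139 * (10 * 1000 * 1000))%Z.
Proof. by vm_compute. Qed.

Lemma chord_sumZE k :
  Z.of_nat (\sum_(j < k) Z.to_nat (chordZ j))%N = chord_sumZ k.
Proof.
elim: k => [|k IH]; first by rewrite big_ord0.
rewrite big_ord_recr /= -IH; have : (0 <= chordZ k)%Z by exact: Z.sqrt_nonneg.
by move: (bigop _ _ _) (chordZ k) => x y; lia.
Qed.

Lemma volume_disc_ge_3139 (R : realType) :
  ((3139 / 1000)%:E <= volume (@unit_ball R 2))%E.
Proof.
(* hiding the values keeps unary numerals from being unfolded *)
have [K KE] : {K | K = 1000%N} by exists 1000%N.
have [M ME] : {M | M = 10%N} by exists 10%N.
have bP j : (j < K + K)%N ->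
    (Z.to_nat (chordZ j) ^ 2 + M ^ 2 * maxn (K - j) (j.+1 - K) ^ 2
       <= M ^ 2 * K ^ 2)%N.
  move=> j2; have mE : maxn (K - j) (j.+1 - K) = cell_dist j by rewrite KE.
  have : (cell_dist j <= K)%N by lia.
  rewrite mE /chordZ; move: (cell_dist j) => m m1.
  have p0 : (0 <= 100 * (1000 * 1000 - Z.of_nat m * Z.of_nat m))%Z by nia.
  have s0 := Z.sqrt_nonneg (100 * (1000 * 1000 - Z.of_nat m * Z.of_nat m)).
  have [s1 _] := Z.sqrt_spec _ p0.
  move: (Z.sqrt _) s0 s1 => s s0 s1.
  have : (s * s + 100 * (Z.of_nat m * Z.of_nat m) <= 100 * (1000 * 1000))%Z by lia.
  by rewrite ME -!mulnn; nia.
have K0 : (0 < K)%N by rewrite KE.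
have M0 : (0 < M)%N by rewrite ME.
apply: le_trans (volume_disc_ge K0 M0 bP).
have KK : (1000 + 1000)%N = (K + K)%N by rewrite KE.
have := chord_sumZ_ge; rewrite -chord_sumZE KK.
move: (\sum_(j < K + K) _)%N => x xP.
have : (3139 * (M * (K * K)) <= 2 * x * K)%N by nia.
rewrite -(ler_nat R) !natrM lee_fin.
have -> : M%:R = 10 :> R by rewrite ME.
have -> : K%:R = 1000 :> R by rewrite KE.
by move: (x%:R) => y H; rewrite ler_pdivlMr; lra.
Qed.

Lemma volume_ball3_ge_3139 (R : realType) :
  ((4 / 3 * (3139 / 1000))%:E <= volume (@unit_ball R 3))%E.
Proof. by apply: volume_ball3_ge; [lra|exact: volume_disc_ge_3139]. Qed.

End DiscArea.

(** * Existence of densest packings *)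

Section Existence.
Context {R : realType}.

Definition hull_volume d (C : set 'rV[R]_d) : \bar R :=
  volume (minkowski_sum (conv_hull C) unit_ball).

Definition separated d n (f : 'I_n -> 'rV[R]_d) :=
  forall i j, i != j -> 2 <= enorm (f i - f j).

Lemma packingsP d n (C : set 'rV[R]_d) : @packings R d n C ->
  exists2 f : 'I_n -> 'rV[R]_d, separated f & C = range f.
Proof.
move=> [pC]; rewrite card_eq_sym => /card_set_bijP[g [gC ginj gsurj]].
exists (fun i : 'I_n => g i).
  move=> i j ij; apply: (is_packingP C).1 => //; try exact: gC (ltn_ord _).
  move=> /ginj gij; case/eqP: ij; apply/val_inj/gij; rewrite inE; exact: ltn_ord.
apply/seteqP; split=> [x Cx|_ [i _ <-]]; last exact: gC (ltn_ord i).
have [k kn <-] := gsurj x Cx.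
by exists (Ordinal kn).
Qed.

Lemma volume_unit_ball_gt0 d : exists2 c : R, 0 < c & (c%:E <= volume (@unit_ball R d))%E.
Proof.
pose e : R := d.+1%:R^-1.
have e0 : 0 < e by rewrite invr_gt0.
exists (\prod_(j < d) (2 * e)); first by apply: prodr_gt0 => j _; rewrite mulr_gt0.
rewrite -(volume_sym_box (a := fun=> e)); last by move=> j; exact: ltW.
apply: le_volume => y ye; rewrite /unit_ball/=.
apply: le_trans (enorm_le_coord (ltW e0) ye) _.
by rewrite /e ler_pdivrMr ?mul1r ?ler_nat.
Qed.

(** Bounded, hence contained in a box. *)
Lemma hull_volume_fin d n (f : 'I_n -> 'rV[R]_d) :
  (hull_volume (range f) < +oo)%E.
Proof.
pose D := \sum_i enorm (f i).
have D0 : 0 <= D by apply: sumr_ge0 => i _; exact: enorm_ge0.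
apply: (@le_lt_trans _ _ (volume [set y : 'rV[R]_d | forall j, `|y 0 j| <= D + 1])).
  apply: le_volume => _ [x Cx [y y1 <-]] j.
  rewrite mxE; apply: le_trans (ler_normD _ _) _; apply: lerD; last first.
    exact: le_trans (coord_le_enorm y j) _.
  move: x Cx; apply: conv_hull_min => [x y' t xD yD t0 t1|_ [i _ <-]].
    rewrite !mxE; apply: le_trans (ler_normD _ _) _.
    rewrite !normrM (ger0_norm t0) (ger0_norm (_ : 0 <= 1 - t)) ?subr_ge0//.
    move: xD yD; nra.
  apply: le_trans (coord_le_enorm (f i) j) _.
  rewrite /D (bigD1 i)//= lerDl; apply: sumr_ge0 => k _; exact: enorm_ge0.
by rewrite volume_sym_box ?ltry// => j; rewrite addr_ge0.
Qed.

Lemma volume_ball_le_hull d (C : set 'rV[R]_d) x : C x ->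
  (volume (@unit_ball R d) <= hull_volume C)%E.
Proof.
move=> Cx; rewrite -[leRHS](volume_translate _ x).
apply: le_volume => y y1; exists x; first exact: sub_conv_hull.
by exists y => //; rewrite addrC.
Qed.

Lemma hull_volume_translate d n (f : 'I_n -> 'rV[R]_d) (v : 'rV[R]_d) :
  hull_volume (range (fun i => f i + v)) = hull_volume (range f).
Proof.
have le (g : 'I_n -> 'rV[R]_d) (u : 'rV[R]_d) :
    (hull_volume (range (fun i => (g i + u)%R)) <= hull_volume (range g))%E.
  rewrite /hull_volume -[leLHS](volume_translate _ u).
  apply: le_volume => z [x Cx [y y1 xyz]].
  exists (x - u).
    move: x Cx {xyz}; apply: conv_hull_min => [x x' t xD yD t0 t1|_ [i _ <-]].
      have -> : t *: x + (1 - t) *: x' - u = t *: (x - u) + (1 - t) *: (x' - u).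
        by apply/rowP => k; rewrite !mxE; ring.
      exact: conv_hull_seg.
    by rewrite addrK; apply: sub_conv_hull; exists i.
  by exists y => //; rewrite addrAC xyz addrK.
apply/eqP; rewrite eq_le le/=.
have := le (fun i => f i + v) (- v).
by rewrite (_ : (fun i => f i + v - v) = f)//; apply/funext => i; rewrite addrK.
Qed.

(** conv f + B lies in conv g + (1 + e) B, which is contained in (1 + e) (conv
    g + B) because 0 is in conv g. *)
Lemma hull_volume_perturb d n (f g : 'I_n -> 'rV[R]_d) (i0 : 'I_n) (e : R) :
  0 < e -> g i0 = 0 -> (forall i, enorm (f i - g i) <= e) ->
  (hull_volume (range f) <= ((1 + e) ^+ d)%:E * hull_volume (range g))%E.
Proof.
move=> e0 g0 fg; have e1 : 0 < 1 + e by lra.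
rewrite /hull_volume (volume_affine _ 0 e1).
rewrite lee_pmul2l ?lte_fin ?exprn_gt0//.
apply: le_volume => z /=; rewrite addr0 => -[x Cx [y y1 xyz]].
have [q [Cq xq]] : exists q, conv_hull (range g) q /\ enorm (x - q) <= e.
  move: x Cx {xyz}; apply: conv_hull_min.
    move=> x x' t [q [Cq xq]] [q' [Cq' xq']] t0 t1.
    exists (t *: q + (1 - t) *: q'); split; first exact: conv_hull_seg.
    have -> : t *: x + (1 - t) *: x' - (t *: q + (1 - t) *: q') =
      t *: (x - q) + (1 - t) *: (x' - q').
      by apply/rowP => k; rewrite !mxE; ring.
    apply: le_trans (enormD _ _) _; rewrite !enormZ.
    rewrite (ger0_norm t0) (ger0_norm (_ : 0 <= 1 - t)) ?subr_ge0//; nra.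
  by move=> _ [i _ <-]; exists (g i); split=> //; apply: sub_conv_hull; exists i.
have ei : `|(1 + e)^-1| = (1 + e)^-1 by rewrite ger0_norm// invr_ge0 ltW.
exists ((1 + e)^-1 *: q).
  have -> : (1 + e)^-1 *: q = (1 + e)^-1 *: q + (1 - (1 + e)^-1) *: 0.
    by rewrite scaler0 addr0.
  apply: conv_hull_seg => //.
  - by apply: sub_conv_hull; exists i0.
  - by rewrite invr_ge0 ltW.
  - by rewrite invf_le1//; lra.
exists ((1 + e)^-1 *: (x - q + y)).
  rewrite /unit_ball/= enormZ ei mulrC ler_pdivrMr// mul1r.
  by apply: le_trans (enormD _ _) _; rewrite addrC lerD.
rewrite -scalerDr addrA [q + _]addrC subrK xyz scalerA mulVf ?scale1r//.
by rewrite gt_eqF.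
Qed.

Lemma expr1D_le d (e : R) : 0 <= e <= 1 -> (1 + e) ^+ d <= 1 + 2 ^+ d * e.
Proof.
move=> /andP[e0 e1]; suff : (1 + e) ^+ d <= 1 + (2 ^+ d - 1) * e by lra.
elim: d => [|d IH]; first by rewrite !expr0; lra.
rewrite !exprS; have : 1 <= 2 ^+ d :> R by rewrite exprn_ege1// ler1n.
move: (2 ^+ d) ((1 + e) ^+ d) IH => x y IH x1.
have h1 : (1 + e) * y <= (1 + e) * (1 + (x - 1) * e) by rewrite ler_wpM2l//; lra.
have h2 : 0 <= (x - 1) * (e * (1 - e)) by rewrite !mulr_ge0//; lra.
nra.
Qed.

Section Minimizer.
Variables (d n : nat).
Local Notation config := ('I_n.+1 -> 'rV[R]_d.+1).

Definition vec_of_config (f : config) : 'rV[R]_(n.+1 * d.+1) :=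
  mxvec (\matrix_(i, j) f i 0 j).

Definition config_of_vec (v : 'rV[R]_(n.+1 * d.+1)) : config :=
  fun i => row i (vec_mx v).

(** Compactness of a cube in the space of all coordinates of all centres. *)
Lemma config_cluster (f_ : nat -> config) (D : R) :
  (forall k i, enorm (f_ k i) <= D) ->
  exists f : config, forall (e : R) (k0 : nat), 0 < e ->
    exists2 k, (k0 <= k)%N & forall i, enorm (f i - f_ k i) <= e.
Proof.
move=> fD.
pose X k := vec_of_config (f_ k).
pose A := [set v : 'rV[R]_(n.+1 * d.+1) | forall i, `[- D, D]%classic (v 0 i)].
have cA : compact A.
  apply: (@rV_compact R _ (fun=> `[- D, D]%classic)) => i.
  exact: segment_compact.
have XA k : A (X k).
  move=> l; case/mxvec_indexP: l => i j.
  rewrite /X /vec_of_config mxvecE mxE /= in_itv/= -ler_norml.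
  exact: le_trans (coord_le_enorm _ _) (fD k i).
have [|v [_ clv]] := cA (X @ \oo) _; first by exists 0%N => // k _; exact: XA.
exists (config_of_vec v) => e k0 e0.
pose e' := e / d.+1%:R.
have e'0 : 0 < e' by rewrite divr_gt0.
have [] := clv [set X k | k in [set k | (k0 <= k)%N]] [set w | forall l, `|v 0 l - w 0 l| < e'].
- by exists k0 => // k k0k; exists k.
- by apply/nbhs_rowP; exists e'.
move=> _ [[k k0k <-] vX]; exists k => // i.
apply: le_trans (enorm_le_coord (ltW e'0) _) _; last first.
  by rewrite /e' mulrCA divff ?mulr1// pnatr_eq0.
move=> j; have := vX (mxvec_index i j); rewrite /X /vec_of_config mxvecE !mxE.
exact: ltW.
Qed.

(** Minimize the volume over configurations whose first centre is 0. Their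
    diameters are bounded because the volume of the parallel body dominates the
    diameter of the hull. *)
Lemma exists_minimal_hull :
  (exists f : config, separated f) ->
  exists2 f : config, separated f &
    forall g : config, separated g -> (hull_volume (range f) <= hull_volume (range g))%E.
Proof.
move=> [f0 sf0].
pose S := [set hull_volume (range f) | f in [set f : config | separated f]].
have [r rE] : exists r : R, ereal_inf S = r%:E.
  have Sf0 : (ereal_inf S <= hull_volume (range f0))%E.
    by apply: ereal_inf_lbound; exists f0.
  have I0 : (0 <= ereal_inf S)%E.
    by apply: le_ereal_inf_tmp => _ [f _ <-]; exact: volume_ge0.
  exists (fine (ereal_inf S)); rewrite fineK// ge0_fin_numE//.
  exact: le_lt_trans Sf0 (hull_volume_fin f0).
have seq k : {f : config | [/\ separated f, f ord0 = 0 &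
    (hull_volume (range f) <= (r + k.+1%:R^-1)%:E)%E]}.
  apply: cid; have k0 : 0 < k.+1%:R^-1 :> R by rewrite invr_gt0.
  have [|_ [f sf <-] fr] := @lb_ereal_inf_adherent _ S _ k0; first by rewrite rE.
  exists (fun i => f i + (- f ord0)); split.
  - move=> i j ij; rewrite (_ : _ - _ = f i - f j); first exact: sf.
    by rewrite opprD addrACA subrr addr0.
  - by rewrite subrr.
  - by rewrite hull_volume_translate EFinD -rE; exact: ltW.
pose f_ k := sval (seq k).
have [c c0 cV] := volume_unit_ball_gt0 d.
have fD k i : enorm (f_ k i) <= (r + 1) / c.
  have [_ f00 fr] := svalP (seq k); rewrite -/(f_ k) in f00 fr.
  rewrite ler_pdivlMr//.
  have := @volume_hull_ge_dist R d (range (f_ k)) (f_ k i) (f_ k ord0).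
  rewrite f00 subr0 => /(_ (sub_conv_hull _) (sub_conv_hull _)) H.
  rewrite -lee_fin EFinM; apply: (@le_trans _ _ ((enorm (f_ k i))%:E * volume (@unit_ball R d))%E).
    by rewrite lee_wpmul2l// lee_fin enorm_ge0.
  apply: le_trans (H _ _) _; try by [exists i|exists ord0].
  apply: le_trans fr _; rewrite lee_fin lerD2l invf_le1 ?ler1n//.
have [f fP] := config_cluster fD.
exists f.
  move=> i j ij; apply/ler_addgt0Pl => e e0.
  have [k _ fk] := fP (e / 2) 0%N (divr_gt0 e0 (ltr0Sn _ 1)).
  have [sk _ _] := svalP (seq k); have := sk i j ij.
  rewrite -[sval _]/(f_ k).
  have -> : f_ k i - f_ k j = (f i - f j) + ((f j - f_ k j) - (f i - f_ k i)).
    by apply/rowP => l; rewrite !mxE; ring.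
  have := enormD (f i - f j) ((f j - f_ k j) - (f i - f_ k i)).
  have := enormD (f j - f_ k j) (- (f i - f_ k i)).
  by rewrite enormN; have := fk i; have := fk j; lra.
move=> g sg; apply: (@le_trans _ _ r%:E); last first.
  by rewrite -rE; apply: ereal_inf_lbound; exists g.
have r0 : 0 <= r.
  rewrite -lee_fin -rE; apply: le_ereal_inf_tmp => _ [h _ <-]; exact: volume_ge0.
have fin : hull_volume (range f) \is a fin_num.
  by rewrite ge0_fin_numE ?volume_ge0//; exact: hull_volume_fin.
rewrite -(fineK fin) lee_fin.
set v := fine _; have vE : v%:E = hull_volume (range f) by rewrite fineK.
have H (e : R) : 0 < e <= 1 -> v <= (1 + 2 ^+ d.+1 * e) * (r + e).
  move=> /andP[e0 e1].
  (* the index bound makes 1 / (k + 1) at most e *)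
  have [k k0k fk] := fP e (Num.truncn e^-1) e0.
  have [_ f00 fr] := svalP (seq k).
  have fg : (hull_volume (range f) <= ((1 + e) ^+ d.+1)%:E * hull_volume (range (f_ k)))%E.
    exact: (hull_volume_perturb e0 f00).
  rewrite -lee_fin vE EFinM; apply: le_trans fg _.
  have h1 : (0 <= ((1 + e) ^+ d.+1)%:E)%E by rewrite lee_fin exprn_ge0//; lra.
  have h2 : (((1 + e) ^+ d.+1)%:E <= (1 + 2 ^+ d.+1 * e)%:E)%E.
    by rewrite lee_fin; apply: expr1D_le; rewrite e1 ltW.
  apply: (lee_pmul h1 (volume_ge0 _) h2).
  apply: le_trans fr _; rewrite lee_fin lerD2l.
  rewrite -[leRHS]invrK lef_pV2 ?posrE ?invr_gt0//.
  by apply/ltW/(lt_le_trans (truncnS_gt _)); rewrite ler_nat ltnS.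
have B0 : 0 <= 2 ^+ d.+1 :> R by rewrite exprn_ge0.
move: (2 ^+ d.+1) B0 H => B B0 H.
rewrite leNgt; apply/negP => rv.
pose q := 1 + B * (r + 1).
have q1 : 0 < 1 + q by rewrite /q; nra.
(* small enough for the inequality of [H] to contradict r < v *)
pose e := Num.min 1 ((v - r) / (1 + q)).
have e0 : 0 < e by rewrite /e lt_min ltr01 divr_gt0// subr_gt0.
have e1 : e <= 1 by rewrite /e ge_min lexx.
have e2 : e * (1 + q) <= v - r by rewrite -ler_pdivlMr// /e ge_min lexx orbT.
have := H e; rewrite e0 e1 => /(_ isT).
have h3 : 0 <= B * (e * (1 - e)) by rewrite !mulr_ge0//; lra.
by move: e2; rewrite /q; lra.
Qed.

End Minimizer.

End Existence.

(** * Dimension of the affine hull *)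

Section AffineDimension.
Context {R : realType} {d : nat}.

Lemma affine_hull_range n (f : 'I_n.+1 -> 'rV[R]_d) :
  affine_hull (range f) =
  [set f ord0 + v | v in [set` <<[seq f i - f ord0 | i : 'I_n.+1]>>%VS]].
Proof.
set X := [seq f i - f ord0 | i : 'I_n.+1].
apply/seteqP; split.
  apply: smallest_sub.
    move=> _ _ t [v vX <-] [w wX <-]; exists ((1 - t) *: v + t *: w).
      by rewrite /= memvD ?memvZ.
    by apply/rowP => k; rewrite !mxE; ring.
  move=> _ [i _ <-]; exists (f i - f ord0); last by rewrite addrC subrK.
  by apply: memv_span; apply/mapP; exists i; rewrite ?mem_enum.
move=> _ [v vX <-] A [affA CA].
pose W u := A (f ord0 + u).
have W0 : W 0 by rewrite /W addr0; apply: CA; exists ord0.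
have WZ t u : W u -> W (t *: u).
  move=> Wu; have := affA _ _ t W0 Wu; rewrite /W.
  by congr A; apply/rowP => k; rewrite !mxE; ring.
have WD u w : W u -> W w -> W (u + w).
  move=> Wu Ww; have := WZ 2 (2^-1 *: (u + w)).
  rewrite scalerA divff ?pnatr_eq0// scale1r; apply.
  have := affA _ _ 2^-1 Wu Ww; rewrite /W.
  by congr A; apply/rowP => k; rewrite !mxE; field.
change (W v); rewrite (coord_span (vX : v \in <<in_tuple X>>%VS)).
elim/big_ind : _ => // i _; apply: WZ.
have : (in_tuple X)`_i \in X by rewrite mem_nth.
move=> /mapP[j _ ->]; rewrite /W addrC subrK; apply: CA.
by exists j.
Qed.

Lemma affine_dim_le (C : set 'rV[R]_d) : (affine_dim C <= d)%N.
Proof.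
rewrite /affine_dim; case: xgetP => // k _ [p [V [_ ->]]].
by rewrite (leq_trans (dimvS (subvf V)))// dimvf dim_matrix mul1r.
Qed.

(** The differences from the first point lie in the direction space of the
    affine hull. *)
Lemma affine_dim_le1 n (f : 'I_n.+1 -> 'rV[R]_d) :
  (affine_dim (range f) <= 1)%N ->
  exists v : 'rV[R]_d, forall i, exists t : R, f i = f ord0 + t *: v.
Proof.
rewrite /affine_dim => dim1.
set S := [set k | _] in dim1.
have /(xgetPex 0%N) [p [V [hullE dimE]]] : exists k, S k.
  by exists (\dim <<[seq f i - f ord0 | i : 'I_n.+1]>>%VS), (f ord0),
    <<[seq f i - f ord0 | i : 'I_n.+1]>>%VS; split=> //; exact: affine_hull_range.
rewrite {}dimE in dim1.
have fV i : f i - f ord0 \in V.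
  have fp j : exists2 v, v \in V & p + v = f j.
    have sub : range f `<=` affine_hull (range f) by exact: sub_smallest.
    have : affine_hull (range f) (f j) by apply: sub; exists j.
    by rewrite hullE => -[v vV <-]; exists v.
  have [v vV <-] := fp i; have [w wV <-] := fp ord0.
  by rewrite opprD addrACA subrr add0r memvB.
have [V0|V0] := eqVneq V 0%VS.
  exists 0 => i; exists 0; have := fV i; rewrite V0 memv0 subr_eq0 => /eqP ->.
  by rewrite scaler0 addr0.
exists (vpick V) => i.
have VE : <[vpick V]>%VS = V.
  apply/eqP; rewrite eqEdim -memvE memv_pick /= dim_vline vpick0 V0/=.
  exact: dim1.
have /vlineP[t ft] : f i - f ord0 \in <[vpick V]>%VS by rewrite VE.
by exists t; rewrite -ft addrC subrK.
Qed.

End AffineDimension.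

(** * Dimension of the densest packings *)

Section Conclusion.
Context {R : realType}.

Lemma hull_volume_EFin n (C : set 'rV[R]_4) : @packings R 4 n.+1 C ->
  exists2 x : R, 0 < x & hull_volume C = x%:E.
Proof.
move=> /packingsP[f _ ->].
have fin : hull_volume (range f) \is a fin_num.
  by rewrite ge0_fin_numE ?volume_ge0// hull_volume_fin.
exists (fine (hull_volume (range f))); last by rewrite fineK.
rewrite -lte_fin fineK//.
have [c c0 cV] := @volume_unit_ball_gt0 R 4.
apply: (@lt_le_trans _ _ c%:E); first by rewrite lte_fin.
by apply: le_trans cV (volume_ball_le_hull (x := f ord0) _); exists ord0.
Qed.

Lemma packing_densityE n (C : set 'rV[R]_4) (x : R) : hull_volume C = x%:E ->
  packing_density n C = n%:R * fine (volume (@unit_ball R 4)) / x.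
Proof. by rewrite /packing_density /hull_volume => ->. Qed.

Lemma fine_volume_ball_gt0 n (C : set 'rV[R]_4) (x : R) :
  @packings R 4 n.+1 C -> hull_volume C = x%:E ->
  0 < fine (volume (@unit_ball R 4)).
Proof.
move=> pC CE; have [c c0 cV] := @volume_unit_ball_gt0 R 4.
have [f _ fE] := packingsP pC.
rewrite fine_gt0//; apply/andP; split.
  by apply: lt_le_trans cV; rewrite lte_fin.
apply: le_lt_trans (volume_ball_le_hull (C := C) (x := f ord0) _) _.
  by rewrite fE; exists ord0.
by rewrite CE ltry.
Qed.

(** The density is a positive constant divided by the volume of the parallel
    body, which is finite and positive. *)
Lemma le_packing_density n (C C' : set 'rV[R]_4) :
  @packings R 4 n.+1 C -> @packings R 4 n.+1 C' ->
  (packing_density n.+1 C' <= packing_density n.+1 C) =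
  (hull_volume C <= hull_volume C')%E.
Proof.
move=> pC pC'; have [x x0 xE] := hull_volume_EFin pC.
have [y y0 yE] := hull_volume_EFin pC'.
have ball0 := fine_volume_ball_gt0 pC xE.
(* explicit congruences, so that no attempt is made to unify the two hulls *)
apply: etrans (f_equal2 (fun a b : R => a <= b)
  (packing_densityE n.+1 yE) (packing_densityE n.+1 xE)) _.
apply: etrans (esym (f_equal2 (fun a b => (a <= b)%E) xE yE)).
by rewrite lee_fin ler_pM2l ?mulr_gt0// lef_pV2.
Qed.

Lemma exists_densest n : (exists C, @packings R 4 n.+1 C) ->
  exists C, @densest_packings R 4 n.+1 C.
Proof.
move=> [C0 /packingsP[f0 sf0 _]].
have [f sf fmin] := exists_minimal_hull (ex_intro _ f0 sf0).
have pf : @packings R 4 n.+1 (range f) by exact: injective_packings.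
exists (range f); split; first exact: pf.
move=> C' pC'; rewrite (le_packing_density pf pC').
by have [g sg ->] := packingsP pC'; exact: fmin.
Qed.

(** A collinear packing has a parallel body of volume at least 2 (n - 1) k3,
    which some other packing undercuts. *)
Lemma densest_dim_gt1 n (C : set 'rV[R]_4) : beats_sausage R n.+1 ->
  densest_packings n.+1 C -> (1 < affine_dim C)%N.
Proof.
move=> [C' pC' vC'] [pC Cmax]; rewrite ltnNge; apply/negP => dim1.
have := Cmax C' pC'; rewrite (le_packing_density pC pC') leNgt => /negP; apply.
apply: lt_le_trans vC' _.
have [f sf CE] := packingsP pC; move: dim1; rewrite CE => /affine_dim_le1[v fv].
have := volume_collinear_ge (C := range f) (fun i => ex_intro2 _ _ i I erefl) sf fv.
apply: le_trans; rewrite -(natr1 n) addrK.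
apply: (@le_trans _ _ ((2 * n%:R)%:E * (4 / 3 * (3139 / 1000))%:E)%E).
  by rewrite -EFinM lee_fin; lra.
by rewrite lee_wpmul2l ?lee_fin ?mulr_ge0// volume_ball3_ge_3139.
Qed.

(** The maximum exists because some densest packing does and the dimensions are
    at most 4. *)
Lemma max_dim_gt1 n : beats_sausage R n.+1 -> (1 < max_dim R 4 n.+1)%N.
Proof.
move=> gn; rewrite /max_dim; set S := [set k | _].
have [C0 dC0] : exists C, @densest_packings R 4 n.+1 C.
  by apply: exists_densest; have [C pC _] := gn; exists C.
have ex : exists k, `[< exists2 C, @densest_packings R 4 n.+1 C & affine_dim C = k >].
  by exists (affine_dim C0); apply/asboolP; exists C0.
have bound k : `[< exists2 C, @densest_packings R 4 n.+1 C & affine_dim C = k >] ->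
    (k <= 4)%N.
  by move=> /asboolP[C _ <-]; exact: affine_dim_le.
have [k /asboolP kC kmax] := ex_maxnP ex bound.
have /(xgetPex 0%N) [[C dC <-] _] : exists k, S k.
  exists k; split=> // C dC; apply: kmax.
  by apply/asboolP; exists C.
exact: densest_dim_gt1 dC.
Qed.

End Conclusion.

Theorem theorem1p6 (R : realType) :
  exists2 N : nat, is_Nstar R 4 N & (N <= 516946)%N.
Proof.
(* hiding the value keeps its unary form from being unfolded *)
have [B BE] : {B | B = 516946%N} by exists 516946%N.
have B0 : (0 < B)%N by rewrite BE.
have beatsB n : (B <= n)%N -> beats_sausage R n by rewrite BE; exact: beats_sausage_ge.
rewrite -BE => {BE}.
pose P M := (0 < M)%N &&
  `[< forall M', (M <= M')%N -> (1 < max_dim R 4 M')%N >].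
have PB : P B.
  rewrite /P B0; apply/asboolP => -[|n] Bn; first lia.
  exact/max_dim_gt1/beatsB.
have exP : exists M, P M by exists B.
have [N /andP[N0 /asboolP NP] Nmin] := ex_minnP exP.
exists N; last exact: Nmin.
split=> // M [M0 MP]; apply: Nmin; rewrite /P M0.
exact/asboolP.
Qed.
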